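(* Suppose that $\Gamma\subset\mathbb{P}^2_{\mathbb{C}}$ is a conic and let $C=V(f)$ be a cubic such that $\Gamma\subseteq E(f)$. Then there are three possible cases: \begin{itemize} \item $\Gamma=\mathcal{Q}_{\mathrm{iso}}$. This is true if and only if $f=\ell\,\mathcal{Q}_{\mathrm{iso}}$, where $\ell$ is any line of the plane. \item $\Gamma$ is bitangent to $\mathcal{Q}_{\mathrm{iso}}$ in two distinct points $P_1$ and $P_2$. This is true if and only if $f=r(\lambda\,\mathcal{Q}_{\mathrm{iso}}+\mu r^2)$, where $\lambda,\mu\in\mathbb{C}$ and $r=P_1\vee P_2$. In this case $\Gamma=V(\lambda\,\mathcal{Q}_{\mathrm{iso}}+3\mu r^2)$. \item $\Gamma$ is hyperosculating $\mathcal{Q}_{\mathrm{iso}}$ in a point $P$. This is true if and only if $f=r(\mathcal{Q}_{\mathrm{iso}}-r^2)$, where $r$ is the tangent to $\mathcal{Q}_{\mathrm{iso}}$ in $P$. In this case $\Gamma=V(\mathcal{Q}_{\mathrm{iso}}-3r^2)$. \end{itemize}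
   Context: $\mathcal{Q}_{\mathrm{iso}}$ denotes the conic $x^2+y^2+z^2=0$ in $\mathbb{P}^2_{\mathbb{C}}$ and also its defining polynomial. $P\vee Q$ is the line through distinct points $P,Q$; a line is identified with a linear form defining it. For a ternary cubic form $f\in\mathbb{C}[x,y,z]_3$, the eigenscheme $E(f)\subset\mathbb{P}^2_{\mathbb{C}}$ is the subscheme defined by the $2\times2$ minors of $\begin{pmatrix}x&y&z\\ \partial_xf&\partial_yf&\partial_zf\end{pmatrix}$. ''Bitangent in $P_1$ and $P_2$'' means that $\Gamma$ and $\mathcal{Q}_{\mathrm{iso}}$ have intersection multiplicity $2$ at each of $P_1,P_2$; ''hyperosculating in $P$'' means that they have intersection multiplicity $4$ at $P$.
   Formalization: In the bitangent case the ''if and only if'' needs μ≠0 (and P1, P2 on Q_iso); in the hyperosculating case the ''if and only if'' is for Γ not a double line (f=r³, Γ=V(r²) is a counterexample), and f=r(Q_iso−r²) holds up to a nonzero scalar with r suitably scaled. *)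

(* Defs.v *)
From mathcomp Require Import all_boot all_order all_algebra.
From mathcomp Require Import fraction mpoly.
From mathcomp Require Import complex.
From mathcomp Require Import reals.

Set Implicit Arguments.
Unset Strict Implicit.
Unset Printing Implicit Defensive.

Import GRing.Theory.
Local Open Scope ring_scope.

(* A point of the projective plane is given by a nonzero row vector of
   homogeneous coordinates; a curve is given by a nonzero form. *)

Section PlaneCurves.
Variable K : fieldType.
Implicit Types (F G q f r : {mpoly K[3]}) (s : seq {mpoly K[3]}).
Implicit Types (P : 'rV[K]_3) (u : {fraction {mpoly K[3]}}).

Definition is_form (d : nat) F : Prop := F \is d.-homog /\ F != 0.

Definition eval_at F P : K := F.@[fun i => P 0 i].

Definition on_curve F P : Prop := eval_at F P = 0.

(* For nonzero vectors: not proportional. *)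
Definition distinct_points P1 P2 : Prop := ~~ (P1 == P2)%MS.

(* V(F) = V(G) as subschemes of the plane. *)
Definition same_curve F G : Prop := exists2 c : K, c != 0 & F = c *: G.

Definition in_ideal s F : Prop :=
  exists h : 'I_(size s) -> {mpoly K[3]}, F = \sum_(i < size s) h i * s`_i.

(* The line V(r) is the join of the distinct points P1 and P2. *)
Definition is_join r P1 P2 : Prop :=
  [/\ is_form 1 r, on_curve r P1 & on_curve r P2].

(* The line V(r) is the tangent to V(F) at the point P (assumed smooth). *)
Definition is_tangent r F P : Prop :=
  on_curve F P /\ same_curve r (\sum_(i < 3) eval_at F^`M(i) P *: 'X_i).

(* The local ring of the plane at P: fractions of forms of the same degree
   whose denominator does not vanish at P. *)
Definition in_local_ring P u : Prop :=
  exists (d : nat) (a b : {mpoly K[3]}),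
    [/\ a \is d.-homog, b \is d.-homog, eval_at b P != 0
      & u = tofrac a / tofrac b].

(* The stalk at P of the ideal sheaf of V(s). *)
Definition in_local_ideal s P u : Prop :=
  exists (d : nat) (a b : {mpoly K[3]}),
    [/\ a \is d.-homog, b \is d.-homog, eval_at b P != 0, in_ideal s a
      & u = tofrac a / tofrac b].

(* dim_K O_P / (F, G)_P = n: the classes of e_0, ..., e_(n-1) form a K-basis
   of the quotient.  No n qualifies when the dimension is infinite. *)
Definition intersection_mult F G P (n : nat) : Prop :=
  exists e : 'I_n -> {fraction {mpoly K[3]}},
    (forall i, in_local_ring P (e i)) /\
    (forall u, in_local_ring P u ->
       exists! c : 'rV[K]_n,
         in_local_ideal [:: F; G] P (u - \sum_(i < n) tofrac (c 0 i)%:MP * e i)).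

(* The 2 x 2 minors of the matrix with rows (x, y, z) and grad f. *)
Definition eigen_minor f (i j : 'I_3) : {mpoly K[3]} :=
  'X_i * f^`M(j) - 'X_j * f^`M(i).

Definition eigen_minors f : seq {mpoly K[3]} :=
  [:: eigen_minor f 0 1; eigen_minor f 0 2%:R; eigen_minor f 1 2%:R].

(* V(q) is a subscheme of E(f).  The ideal (q) of K[x, y, z] is saturated, so
   this is an inclusion of ideals. *)
Definition curve_in_eigenscheme q f : Prop :=
  forall g, in_ideal (eigen_minors f) g -> in_ideal [:: q] g.

Definition Qiso : {mpoly K[3]} := \sum_(i < 3) 'X_i ^+ 2.

Definition bitangent_Qiso q P1 P2 : Prop :=
  intersection_mult q Qiso P1 2 /\ intersection_mult q Qiso P2 2.

Definition hyperosculating_Qiso q P : Prop := intersection_mult q Qiso P 4.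

Definition double_line q : Prop :=
  exists2 l : {mpoly K[3]}, is_form 1 l & same_curve q (l ^+ 2).

End PlaneCurves.

Arguments Qiso {K}.

(* Main.v *)
Require Import Defs.
From HB Require Import structures.
From mathcomp Require Import all_boot all_order all_algebra.
From mathcomp Require Import fraction mpoly.
From mathcomp Require Import complex.
From mathcomp Require Import reals.
From mathcomp Require Import ring.

Set Implicit Arguments.
Unset Strict Implicit.
Unset Printing Implicit Defensive.

Import GRing.Theory Num.Theory.
Local Open Scope ring_scope.

(** If [q] divides the minors of [(X, grad f)], the syzygies of [X] give a
    constant vector [a] and a linear form [g] with [grad f = q a + g X].  Symmetry
    of the Hessian of [f] then makes [grad q - 2 c X] proportional to [a] for some
    [c], so that, with [l = a . X],
      [q = c Q + m l^2]   and   [f = l (c Q + (m / 3) l^2)].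
    Hence [(q, Q) = (l^2, Q)] when [m != 0].  Near a point [P] of the conic [Q],
    the rational parametrization [P + t N + t^2 r / 2], with [r] isotropic,
    [P . r = 1] and [N = cross P r], identifies the local ring of [Q] with that of
    the line, so the intersection multiplicity is the order of vanishing in [t]
    of the pullback of [l^2]: it is 2 if [l] is a secant and 4 if it is the
    tangent at [P]. *)

(** The classification produces [f] from a line [l] of its own choosing, while the converse
    implications start from a prescribed line [r]. The two are compared by recovering the conic from
    the cubic: the gradient of [r (c Q + m r^2)] is [(c Q + 3 m r^2) a] plus a multiple of [X], so
    its minors are [c Q + 3 m r^2] times the coordinates of the cross product of [X] and [a]. The
    delicate case is [c = 0]. A double tangent line also meets [Q] with multiplicity 4, but its
    cubic is a multiple of [l^3], which no rescaling of [l] brings to the form [r (Q - r^2)]. For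
    [c] and [m] nonzero, a square root absorbs the ratio [m / c] into [r], and [f] is then known up
    to a scalar. Multiplicity is witnessed by a basis of the local quotient, here the powers of [t]
    below the order of vanishing. Lower bounds need only linear independence, so they also show that
    no finite multiplicity exists when the conic is [Q] itself. *)

Lemma ord3P (i : 'I_3) : [\/ i = 0, i = 1 | i = 2%:R].
Proof.
by case: i => [[|[|[|//]]] ?]; [constructor 1|constructor 2|constructor 3];
  apply/val_inj.
Qed.

Lemma sum3 (V : nmodType) (F : 'I_3 -> V) :
  \sum_(i < 3) F i = F 0 + F 1 + F 2%:R.
Proof.
rewrite !big_ord_recl big_ord0 addr0 addrA.
by congr (_ + F _ + F _); apply/val_inj.
Qed.

(** * Bilinear dot product, cross product and isotropic frames *)

Section Vectors.
Variable R : comNzRingType.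
Implicit Types x y p : 'I_3 -> R.

Definition dot x y : R := \sum_(i < 3) x i * y i.

(** Indices are added modulo 3 in ['I_3], so one cyclic formula gives all coordinates. *)
Definition cross x y : 'I_3 -> R :=
  fun i => x (i + 1) * y (i + 2%:R) - x (i + 2%:R) * y (i + 1).

Lemma crossE x y :
  [/\ cross x y 0 = x 1 * y 2%:R - x 2%:R * y 1,
      cross x y 1 = x 2%:R * y 0 - x 0 * y 2%:R
    & cross x y 2%:R = x 0 * y 1 - x 1 * y 0].
Proof.
rewrite /cross.
have -> : (1 + 1 : 'I_3) = 2%:R by apply/val_inj.
have -> : (1 + 2%:R : 'I_3) = 0 by apply/val_inj.
have -> : (2%:R + 1 : 'I_3) = 0 by apply/val_inj.
have -> : (2%:R + 2%:R : 'I_3) = 1 by apply/val_inj.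
by rewrite !add0r.
Qed.

Lemma dotC x y : dot x y = dot y x.
Proof. by apply: eq_bigr => i _; rewrite mulrC. Qed.

(** The square of a determinant is the Gram determinant of its three rows. *)
Lemma dot_cross x y z :
  dot z (cross x y) ^+ 2 =
  dot x x * dot y y * dot z z + dot x y * dot y z * dot x z *+ 2
  - dot x x * dot y z ^+ 2 - dot y y * dot x z ^+ 2 - dot z z * dot x y ^+ 2.
Proof. by rewrite /dot !sum3; case: (crossE x y) => -> -> ->; ring. Qed.

Lemma dot_crossl x y : dot x (cross x y) = 0.
Proof. by rewrite /dot !sum3; case: (crossE x y) => -> -> ->; ring. Qed.

Lemma dot_crossr x y : dot y (cross x y) = 0.
Proof. by rewrite /dot !sum3; case: (crossE x y) => -> -> ->; ring. Qed.

Lemma dot_cross_cross x y :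
  dot (cross x y) (cross x y) = dot x x * dot y y - dot x y ^+ 2.
Proof. by rewrite /dot !sum3; case: (crossE x y) => -> -> ->; ring. Qed.

(* Expansion of [x] in the basis [p], [p'], [cross p p'], after clearing the
   Gram determinant. *)
Lemma cross_expand x p p' i :
  (dot p p * dot p' p' - dot p p' ^+ 2) * x i =
  dot x (cross p p') * cross p p' i
  + (dot x p * dot p' p' - dot x p' * dot p p') * p i
  + (dot x p' * dot p p - dot x p * dot p p') * p' i.
Proof.
rewrite /dot !sum3; have [E0 E1 E2] := crossE p p'; rewrite E0 E1 E2.
by case: (ord3P i) => ->; rewrite ?E0 ?E1 ?E2; ring.
Qed.

(** The frame [p], [p'], [cross p p'] is a hyperbolic plane plus an orthogonal vector of norm -1;
    the Gram determinant of [p] and [p'] is -1, so [cross_expand] can be solved for [x i] in any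
    ring. *)
Lemma isotropic_expand x p p' i :
  dot p p = 0 -> dot p' p' = 0 -> dot p p' = 1 ->
  x i = dot x p' * p i - dot x (cross p p') * cross p p' i + dot x p * p' i.
Proof.
move=> h h' h1; have := cross_expand x p p' i.
rewrite h h' h1 => E; apply: (addrI ((0 * 0 - 1 ^+ 2) * x i)).
rewrite {2}E; ring.
Qed.

Lemma isotropic_norm x p p' :
  dot p p = 0 -> dot p' p' = 0 -> dot p p' = 1 ->
  dot x x = dot x p' * dot x p *+ 2 - dot x (cross p p') ^+ 2.
Proof.
move=> h h' h1; have := dot_cross p p' x.
rewrite h h' h1 (dotC p' x) (dotC p x) => ->; ring.
Qed.

End Vectors.

Lemma rmorph_dot (R S : comNzRingType) (f : {rmorphism R -> S}) x y :
  f (dot x y) = dot (f \o x) (f \o y).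
Proof. by rewrite rmorph_sum; apply: eq_bigr => i _; rewrite rmorphM. Qed.

(** * Induction principles for forms and polynomials *)

Section MPolyInduction.
Variables (n : nat) (R : comNzRingType).
Local Notation S := {mpoly R[n]}.

Lemma dhomog_ind d (P : S -> Prop) :
  P 0 -> (forall F G, P F -> P G -> P (F + G)) ->
  (forall c m, mdeg m = d -> P (c *: 'X_[m])) ->
  forall F, F \is d.-homog -> P F.
Proof.
move=> P0 PD PX F /dhomogP hF; rewrite (mpolyE F) big_seq.
by apply: big_ind => // m /hF; apply: PX.
Qed.

Lemma mpoly_ring_ind (Q : S -> Prop) :
  (forall c, Q c%:MP) -> (forall i, Q 'X_i) ->
  (forall F q, Q F -> Q q -> Q (F + q)) ->
  (forall F q, Q F -> Q q -> Q (F * q)) -> forall F, Q F.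
Proof.
move=> QC QX QD QM F; elim/mpolyind: F => [|c m F _ _ QF].
  by rewrite -mpolyC0; apply: QC.
apply: (QD) => //; rewrite -mul_mpolyC; apply: (QM); first exact: QC.
rewrite mpolyXE_id; apply: big_ind => [|x y|i _].
- by rewrite -mpolyC1; apply: (QC).
- exact: QM.
- elim: (m i) => [|k IH]; last by rewrite exprS; apply: QM.
  by rewrite expr0 -mpolyC1; apply: QC.
Qed.

End MPolyInduction.

(** * Normal form of a cubic whose eigenscheme contains a conic *)

Section Forms.
Variable K : numFieldType.
Local Notation S := {mpoly K[3]}.
Local Notation X := (fun i : 'I_3 => 'X_i : S).
Implicit Types (F G q f l : S) (a b : 'I_3 -> K).

Definition lin a : S := \sum_(i < 3) a i *: 'X_i.

Lemma linE a : lin a = dot X (fun i => (a i)%:MP).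
Proof. by apply: eq_bigr => i _; rewrite -mul_mpolyC mulrC. Qed.

Lemma Qiso_dot : Qiso = dot X X :> S.
Proof. by apply: eq_bigr => i _; rewrite expr2. Qed.

Lemma mderivXi (i j : 'I_3) : ('X_j : S)^`M(i) = (j == i)%:R.
Proof.
rewrite mderivX mnm1E; case: eqP => [->|_]; last by rewrite scale0r.
have -> : (U_(i) - U_(i) = 0)%MM by apply/mnmP=> k; rewrite mnmBE mnm0E subnn.
by rewrite scale1r mpolyX0.
Qed.

Lemma sum_mderivX (j : 'I_3) (F : 'I_3 -> S) :
  \sum_(i < 3) ('X_j : S)^`M(i) * F i = F j.
Proof.
rewrite (bigD1 j) //= mderivXi eqxx mul1r big1 ?addr0 // => i.
by rewrite eq_sym mderivXi => /negPf ->; rewrite mul0r.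
Qed.

Lemma mderiv_lin a i : (lin a)^`M(i) = (a i)%:MP.
Proof.
rewrite /lin linear_sum /= -(sum_mderivX i (fun i => (a i)%:MP)).
by apply: eq_bigr => j _; rewrite mderivZ !mderivXi eq_sym -mul_mpolyC mulrC.
Qed.

Lemma mderiv_Qiso i : (Qiso : S)^`M(i) = 'X_i *+ 2.
Proof.
rewrite /Qiso linear_sum /= -(sum_mderivX i (fun i => 'X_i *+ 2)).
apply: eq_bigr => j _; rewrite expr2 mderivM !mderivXi eq_sym; ring.
Qed.

Lemma lin_eq0 a : lin a = 0 -> forall i, a i = 0.
Proof.
move=> a0 i; have := mderiv_lin a i; rewrite a0 mderiv0 => /esym/eqP.
by rewrite mpolyC_eq0 => /eqP.
Qed.

Lemma homog_mderiv d F i : F \is d.+1.-homog -> F^`M(i) \is d.-homog.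
Proof.
move/dhomogP=> hF; apply/dhomogP => m; rewrite mcoeff_msupp mcoeff_mderiv => h.
have: (m + U_(i))%MM \in msupp F.
  by rewrite mcoeff_msupp; apply: contraNneq h => ->; rewrite mul0rn.
by move/hF => /=; rewrite mdegD mdeg1 addn1 => -[].
Qed.

Lemma homog0C F : F \is 0.-homog -> F = (F@_0%MM)%:MP.
Proof.
move/dhomogP=> hF; apply/mpolyP => m; rewrite mcoeffC.
case: eqP => [<-|/eqP m0]; first by rewrite mulr1.
rewrite mulr0; apply/eqP; rewrite -[_ == 0]negbK -mcoeff_msupp.
by apply: contra m0 => /hF/eqP; rewrite mdeg_eq0 eq_sym.
Qed.

Lemma euler d F : F \is d.-homog -> \sum_(i < 3) 'X_i * F^`M(i) = F *+ d.
Proof.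
move: F; apply: dhomog_ind => [|F G hF hG|c m <-].
- by rewrite mul0rn big1 // => i _; rewrite mderiv0 mulr0.
- rewrite mulrnDl -hF -hG -big_split /=.
  by apply: eq_bigr => i _; rewrite mderivD mulrDr.
rewrite mdegE -sumrMnr; apply: eq_bigr => i _.
rewrite mderivZ mderivX -!scalerAr -mpolyXD.
have [->|mi] := eqVneq (m i) 0%N; first by rewrite scale0r scaler0 mulr0n.
rewrite addmC submK ?scaler_nat ?scalerMnr //.
by apply/mnm_lepP => j; rewrite mnm1E; case: eqP => [<-|//]; rewrite lt0n.
Qed.

Lemma homog_lin F : F \is 1.-homog -> exists a, F = lin a.
Proof.
move=> hF; exists (fun i => (F^`M(i))@_0%MM).
rewrite linE -[LHS]mulr1n -(euler hF); apply: eq_bigr => i _.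
by rewrite -homog0C // homog_mderiv.
Qed.

Lemma lin_homog a : lin a \is 1.-homog.
Proof. by apply: rpred_sum => i _; rewrite rpredZ // dhomogX /= mdeg1. Qed.

Lemma Qiso_homog : (Qiso : S) \is 2.-homog.
Proof.
by apply: rpred_sum => i _; rewrite mpolyXn dhomogX /= mdegMn mdeg1.
Qed.

(** Allows a quotient by the form [q] to be replaced by its graded piece of the expected degree. *)
Lemma pihomogMr d e h q :
  q \is e.-homog -> pihomog mdeg (d + e) (h * q) = pihomog mdeg d h * q.
Proof.
move=> hq; elim/mpolyind: h => [|c m p _ _ IH].
  by rewrite mul0r !pihomog0 mul0r.
rewrite mulrDl !pihomogD IH mulrDl -!scalerAl !linearZ /= -scalerAl.
congr (c *: _ + _); rewrite pihomogX.
have hX : 'X_[m] * q \is (mdeg m + e).-homog by rewrite dhomogM // dhomogX.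
case: eqP => [<-|/eqP md]; first by rewrite pihomog_dE.
by rewrite mul0r (pihomog_ne0 _ hX) // eqn_add2r.
Qed.

(* Apply [\sum_i d/dX_i] to the hypothesis and use Euler's identity. *)
Lemma proportional_to_X d (W : 'I_3 -> S) :
  (forall i, W i \is d.-homog) ->
  (forall i j, 'X_i * W j = 'X_j * W i) ->
  forall j, W j *+ (d + 2) = 'X_j * \sum_(i < 3) (W i)^`M(i).
Proof.
move=> hW hX j.
have: \sum_(i < 3) ('X_i * W j)^`M(i) = \sum_(i < 3) ('X_j * W i)^`M(i).
  by apply: eq_bigr => i _; rewrite hX.
under eq_bigr => i _ do rewrite mderivM.
rewrite big_split /= (euler (hW j)).
under [RHS]eq_bigr => i _ do rewrite mderivM.
rewrite big_split /= sum_mderivX -mulr_sumr.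
under eq_bigr => i _ do rewrite mderivXi eqxx mul1r.
rewrite sumr_const card_ord => E.
apply: (addrI (W j)); rewrite -E; ring.
Qed.

(* Differentiating [dot X L = 0] gives [L = - 1/2 cross X (curl L)]. *)
Lemma orthogonal_to_X (L : 'I_3 -> S) :
  (forall i, L i \is 1.-homog) -> dot X L = 0 ->
  exists a, forall i, L i = cross X (fun i => (a i)%:MP) i.
Proof.
move=> hL h0.
have E j : L j + \sum_(i < 3) 'X_i * (L i)^`M(j) = 0.
  transitivity ((dot X L)^`M(j)); last by rewrite h0 mderiv0.
  rewrite /dot linear_sum /=.
  under [RHS]eq_bigr => i _ do rewrite mderivM.
  rewrite big_split /=; congr (_ + _); rewrite -(sum_mderivX j L).
  by apply: eq_bigr => i _; rewrite !mderivXi eq_sym.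
have D j : L j = \sum_(i < 3) 'X_i * (L j)^`M(i).
  by rewrite (euler (hL j)) mulr1n.
have C i j : (L i)^`M(j) = (((L i)^`M(j))@_0%MM)%:MP.
  by apply: homog0C; apply: homog_mderiv.
pose c i j : K := ((L i)^`M(j))@_0%MM.
pose curl i := c (i + 2%:R) (i + 1) - c (i + 1) (i + 2%:R).
exists (fun i => - 2%:R^-1 * curl i) => j.
pose cc := fun i => (curl i)%:MP : S.
have hc i : (- 2%:R^-1 * curl i)%:MP = (- 2%:R^-1)%:MP * cc i :> S.
  by rewrite -mpolyCM.
have F : cross X cc j = - L j - L j.
  have -> : - L j - L j = \sum_(i < 3) 'X_i * ((L i)^`M(j) - (L j)^`M(i)).
    under [RHS]eq_bigr => i _ do rewrite mulrBr.
    rewrite sumrB -D; congr (_ - _); apply/esym/eqP.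
    by rewrite -addr_eq0 addrC E.
  rewrite sum3 /cross /cc /curl.
  have e12 : (1 + 1 : 'I_3) = 2%:R by apply/val_inj.
  have e11 : (1 + 2%:R : 'I_3) = 0 by apply/val_inj.
  have e21 : (2%:R + 1 : 'I_3) = 0 by apply/val_inj.
  have e22 : (2%:R + 2%:R : 'I_3) = 1 by apply/val_inj.
  case: (ord3P j) => ->; rewrite ?(add0r, e12, e11, e21, e22) !mpolyCB -!C; ring.
have -> : cross X (fun i => (- 2%:R^-1 * curl i)%:MP) j
        = (- 2%:R^-1)%:MP * cross X cc j.
  rewrite /cross !hc; ring.
have h2 : (2%:R^-1)%:MP *+ 2 = 1 :> S.
  by rewrite -mpolyCMn -[2%:R^-1 *+ 2]mulr_natr mulVf ?pnatr_eq0.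
rewrite F mpolyCN; transitivity (((2%:R^-1)%:MP *+ 2) * L j); last by ring.
by rewrite h2 mul1r.
Qed.

Lemma lin_neq0 a : lin a != 0 -> exists i, a i != 0.
Proof.
move=> a0; apply/existsP; apply: contraNT a0.
rewrite negb_exists => /forallP h; apply/eqP/big1 => i _.
by have := h i; rewrite negbK => /eqP ->; rewrite scale0r.
Qed.


(** The form [q - c Q] has its gradient parallel to a constant vector, so it varies only with
    [lin a]; having degree 2, it is a multiple of [lin a ^+ 2]. *)
Lemma gradient_parallel q a c : q \is 2.-homog -> (exists i, a i != 0) ->
  (forall i j, (q^`M(i) - c *: 'X_i *+ 2) * (a j)%:MP
             = (q^`M(j) - c *: 'X_j *+ 2) * (a i)%:MP) ->
  exists m, q = c *: Qiso + m *: lin a ^+ 2.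
Proof.
move=> hq [k ak] hE; pose F := q - c *: Qiso.
have FE i : F^`M(i) = q^`M(i) - c *: 'X_i *+ 2.
  by rewrite mderivB mderivZ mderiv_Qiso -scalerMnr.
have hF : F \is 2.-homog by rewrite rpredB // rpredZ // Qiso_homog.
pose s := F^`M(k).
have E1 i : F^`M(i) * (a k)%:MP = s * (a i)%:MP by rewrite /s !FE hE.
have E2 : F *+ 2 * (a k)%:MP = lin a * s.
  rewrite -(euler hF) mulr_suml linE /dot mulr_suml.
  by apply: eq_bigr => i _; rewrite -mulrA E1; ring.
pose m0 := (s^`M(k))@_0%MM.
have E3 : s^`M(k) = m0%:MP by apply: homog0C; do 2! apply: homog_mderiv.
have E4 : s * (a k)%:MP = lin a * m0%:MP.
  (* Differentiating [E2] gives [2 s a_k = s a_k + m0 lin a]; with [E2] this yields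
     [2 a_k^2 F = m0 (lin a)^2], the origin of the witness below. *)
  have := congr1 (mderiv k) E2.
  rewrite !mderivM raddfMn -/s mderivC mulr0 addr0 mderiv_lin E3 => E.
  apply: (addrI (s * (a k)%:MP)); transitivity (s *+ 2 * (a k)%:MP); first ring.
  by rewrite [LHS]E; ring.
exists (m0 / (a k ^+ 2 *+ 2)).
suff h : F = (m0 / (a k ^+ 2 *+ 2)) *: lin a ^+ 2 by rewrite -h addrC subrK.
have nz : a k ^+ 2 *+ 2 != 0 by rewrite mulrn_eq0 expf_eq0 (negPf ak).
apply: (scalerI nz); rewrite scalerA mulrC divfK // -!mul_mpolyC.
rewrite mpolyCMn rmorphXn /=.
transitivity ((F *+ 2 * (a k)%:MP) * (a k)%:MP); first by ring.
by rewrite E2 -mulrA E4; ring.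
Qed.

Theorem eigenscheme_conic q f :
  is_form 2 q -> is_form 3 f -> curve_in_eigenscheme q f ->
  exists a c m, [/\ lin a != 0, q = c *: Qiso + m *: lin a ^+ 2
    & f = lin a * (c *: Qiso + (m / 3%:R) *: lin a ^+ 2)].
Proof.
move=> [hq q0] [hf f0] hqf.
pose G i := f^`M(i).
have hG i : G i \is 2.-homog by apply: homog_mderiv.
have hL i : exists l, l \is 1.-homog /\ cross X G i = q * l.
  have [h hh] : exists h, cross X G i = h * q.
    have: in_ideal [:: q] (cross X G i).
      apply: hqf; rewrite /eigen_minors.
      have hin (k : 'I_3) (c : S) :
        in_ideal (eigen_minors f) (c * (eigen_minors f)`_k).
        exists (fun i => if i == k then c else 0).
        rewrite (bigD1 k) //= eqxx big1 ?addr0 // => j /negPf ->.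
        by rewrite mul0r.
      have [E0 E1 E2] := crossE X G.
      case: (ord3P i) => ->; rewrite ?E0 ?E1 ?E2.
      - rewrite (_ : _ - _ = 1 * (eigen_minors f)`_2); first exact: (hin 2%:R).
        by rewrite mul1r.
      - rewrite (_ : _ - _ = -1 * (eigen_minors f)`_1); first exact: (hin 1).
        by rewrite /= /eigen_minor /G; ring.
      - rewrite (_ : _ - _ = 1 * (eigen_minors f)`_0); first exact: (hin 0).
        by rewrite mul1r.
    by case=> h ->; exists (h 0); rewrite big_ord_recl big_ord0 addr0.
  (* The quotient [h] given by ideal membership may be inhomogeneous; since the minor is cubic and
     [q] quadratic, its linear part is already a quotient. *)
  exists (pihomog mdeg 1 h); split; first exact: pihomogP.
  have hc : cross X G i \is (1 + 2).-homog.
    by rewrite rpredB // dhomogM // dhomogX /= mdeg1.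
  by rewrite -(pihomog_dE hc) hh (pihomogMr _ _ hq) mulrC.
have [L hL'] := fin_all_exists hL.
have h0 : dot X L = 0.
  apply: (mulfI q0); rewrite mulr0 -(dot_crossl X G) /dot mulr_sumr.
  by apply: eq_bigr => i _; rewrite (hL' i).2; ring.
have [a hLa] := orthogonal_to_X (fun i => (hL' i).1) h0.
pose A i := (a i)%:MP : S.
pose W i := G i - q * A i.
have hA i : A i \is 0.-homog by rewrite -[A i]mulr1 mul_mpolyC rpredZ ?dhomog1.
have hW i : W i \is 2.-homog by rewrite rpredB // (@dhomogM _ _ _ 2 _ 0).
have hWc i : cross X W i = 0.
  transitivity (cross X G i - q * cross X A i).
    by rewrite /cross /W; ring.
  by rewrite (hL' i).2 hLa subrr.
have hWX i j : 'X_i * W j = 'X_j * W i.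
  have := (hWc 0, hWc 1, hWc 2%:R); have [-> -> ->] := crossE X W.
  move=> [[/subr0_eq h12 /subr0_eq h20] /subr0_eq h01].
  by case: (ord3P i) => ->; case: (ord3P j) => ->.
have hWg := proportional_to_X hW hWX.
(* The 4 is [d + 2] in [proportional_to_X] for the quadratic forms [W i]. *)
pose g : S := (4%:R^-1) *: \sum_(i < 3) (W i)^`M(i).
have hg : g \is 1.-homog.
  by rewrite rpredZ // rpred_sum // => i _; apply: homog_mderiv.
have Wg j : W j = 'X_j * g.
  have n4 : 4%:R != 0 :> K by rewrite pnatr_eq0.
  by rewrite -scalerAr -hWg -scaler_nat scalerA mulVf // scale1r.
have Gg j : f^`M(j) = q * A j + 'X_j * g by rewrite -Wg addrC subrK.
have [b gb] := homog_lin hg.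
pose B i := (b i)%:MP : S.
(* Equality of the mixed partials of [f]; the terms in [g] occur only for [i = j] and cancel. *)
have hE i j : q^`M(i) * A j + 'X_j * B i = q^`M(j) * A i + 'X_i * B j.
  have := mderiv_comm i j f.
  rewrite !Gg !mderivD !mderivM !mderivC !mderivXi gb !mderiv_lin -/(B i) -/(B j).
  by rewrite eq_sym; move/eqP; rewrite -subr_eq0 => /eqP E;
    apply/eqP; rewrite -subr_eq0 -oppr_eq0; apply/eqP; rewrite -[RHS]E; ring.
(* Weighting the three relations [hE] cyclically by the coordinates of [a] eliminates the
   derivatives of [q] and leaves the triple product of [X], [a], [b]. *)
have abX : lin (cross a b) = 0.
  have [E0 E1 E2] := crossE a b.
  rewrite linE /dot sum3 E0 E1 E2 !mpolyCB !mpolyCM -!/(A _) -!/(B _).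
  transitivity (A 2%:R * (q^`M(0) * A 1 + 'X_1 * B 0 - (q^`M(1) * A 0 + 'X_0 * B 1))
    + A 0 * (q^`M(1) * A 2%:R + 'X_(2%:R) * B 1
             - (q^`M(2%:R) * A 1 + 'X_1 * B 2%:R))
    + A 1 * (q^`M(2%:R) * A 0 + 'X_0 * B 2%:R
             - (q^`M(0) * A 2%:R + 'X_(2%:R) * B 0))).
    ring.
  by rewrite (hE 0 1) (hE 1 2%:R) (hE 2%:R 0) !subrr !mulr0 !addr0.
have ab i j : a i * b j = a j * b i.
  have := (lin_eq0 abX 0, lin_eq0 abX 1, lin_eq0 abX 2%:R).
  have [-> -> ->] := crossE a b.
  move=> [[/subr0_eq h12 /subr0_eq h20] /subr0_eq h01].
  by case: (ord3P i) => ->; case: (ord3P j) => ->.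
(* Euler's identity. Once [g = 2 c l] and [q = c Q + m l^2] are known, it reads
   [3 f = l (3 c Q + m l^2)], whence the coefficient [m / 3]. *)
have f3 : f *+ 3 = q * lin a + Qiso * g.
  rewrite -(euler hf) linE Qiso_dot /dot mulr_sumr mulr_suml -big_split /=.
  by apply: eq_bigr => i _; rewrite Gg; ring.
(* If [a = 0], then [hE] makes [X] parallel to the constant vector [b], so [b = 0], [g = 0] and
   [3 f = 0]. *)
have a0 : lin a != 0.
  apply: contra_neq f0 => a0; have {}a0 i := lin_eq0 a0 i.
  have b0 : forall i, b i = 0.
    suff bX i j : i != j -> b i = 0.
      by move=> i; apply: (bX i (i + 1)); case: (ord3P i) => ->.
    move=> ij; have := congr1 (mderiv j) (hE i j).
    rewrite /A !a0 mpolyC0 !mulr0 !add0r !mderivM !mderivC !mulr0 !addr0.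
    rewrite !mderivXi eqxx mul1r (negPf ij) mul0r => /eqP.
    by rewrite mpolyC_eq0 => /eqP.
  have g0 : g = 0 by rewrite gb /lin big1 // => i _; rewrite b0 scale0r.
  have q3 : f *+ 3 = 0.
    by rewrite f3 g0 mulr0 addr0 /lin big1 ?mulr0 // => i _; rewrite a0 scale0r.
  have n3 : 3%:R != 0 :> K by rewrite pnatr_eq0.
  by apply: (scalerI n3); rewrite scaler_nat q3 scaler0.
have [k ak] := lin_neq0 a0.
have n2 : 2%:R != 0 :> K by rewrite pnatr_eq0.
(* The factor 2 matches the gradient [2 X] of [Q]: with it [hE] says that [grad q - 2 c X] is
   parallel to [a]. *)
have [c bc] : exists c, forall i, b i = 2%:R * c * a i.
  exists (b k / a k / 2%:R) => i; apply: (mulfI ak).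
  rewrite ab [RHS](_ : _ = a k / a k * (2%:R / 2%:R) * (a i * b k)).
    by rewrite !divff // !mul1r.
  by ring.
have gE : g = (2%:R * c) *: lin a.
  by rewrite gb /lin scaler_sumr; apply: eq_bigr => i _; rewrite scalerA bc.
have [i j|m qE] := @gradient_parallel q a c hq (lin_neq0 a0).
  have := hE i j; rewrite /B !bc !mpolyCM -/(A _) => E.
  apply/eqP; rewrite -subr_eq0; apply/eqP.
  rewrite -!mul_mpolyC -/(A i) -/(A j).
  rewrite rmorph_nat in E.
  transitivity (q^`M(i) * A j + 'X_j * (2%:R * c%:MP * A i)
    - (q^`M(j) * A i + 'X_i * (2%:R * c%:MP * A j))); first by ring.
  by rewrite E subrr.
exists a, c, m; split=> //.
have n3 : 3%:R != 0 :> K by rewrite pnatr_eq0.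
apply: (scalerI n3); rewrite scaler_nat f3 gE qE.
rewrite [RHS]scalerAr scalerDr !scalerA [3%:R * (m / _)]mulrC divfK //.
rewrite -!mul_mpolyC !mpolyCM !rmorph_nat; ring.
Qed.

End Forms.

(** * Local ideals and intersection multiplicity *)

Section LocalIdeal.
Variable K : fieldType.
Local Notation S := {mpoly K[3]}.
Implicit Types (F G q : S) (P : 'rV[K]_3) (w : {fraction S}).

Lemma eval_atM F G P : eval_at (F * G) P = eval_at F P * eval_at G P.
Proof. exact: mevalM. Qed.

Lemma in_ideal2P F G q :
  in_ideal [:: F; G] q <-> exists A B, q = A * F + B * G.
Proof.
split=> [[h ->]|[A [B ->]]].
  exists (h 0), (h 1); rewrite !big_ord_recl big_ord0 addr0 /=.
  by congr (_ + h _ * _); apply/val_inj.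
exists (fun i => if i == 0 then A else B).
by rewrite !big_ord_recl big_ord0 addr0.
Qed.

Lemma in_ideal2M F G q h : in_ideal [:: F; G] q -> in_ideal [:: F; G] (h * q).
Proof.
move=> /in_ideal2P[A [B ->]]; apply/in_ideal2P.
by exists (h * A), (h * B); rewrite mulrDr !mulrA.
Qed.

Lemma in_ideal2D F G q q' :
  in_ideal [:: F; G] q -> in_ideal [:: F; G] q' -> in_ideal [:: F; G] (q + q').
Proof.
move=> /in_ideal2P[A [B ->]] /in_ideal2P[A' [B' ->]]; apply/in_ideal2P.
by exists (A + A'), (B + B'); ring.
Qed.

Lemma neq0_eval_at F P : eval_at F P != 0 -> tofrac F != 0.
Proof. by rewrite tofrac_eq0; apply: contraNneq => ->; rewrite /eval_at meval0. Qed.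

Variables (F G : S) (P : 'rV[K]_3).
Local Notation I := (in_local_ideal [:: F; G] P).

Lemma in_local_ideal0 : I 0.
Proof.
exists 0%N, 0, 1; split; rewrite ?dhomog0 ?dhomog1 ?rmorph0 ?mul0r //.
- by rewrite /eval_at meval1 oner_neq0.
- by apply/in_ideal2P; exists 0, 0; rewrite !mul0r addr0.
Qed.

Lemma in_local_idealD w w' : I w -> I w' -> I (w + w').
Proof.
move=> [d [a [b [ha hb bP Ia ->]]]] [d' [a' [b' [ha' hb' bP' Ia' ->]]]].
exists (d + d')%N, (a * b' + a' * b), (b * b'); split.
- by apply: rpredD; [|rewrite mulrC]; apply: dhomogM.
- by rewrite dhomogM.
- by rewrite eval_atM mulf_neq0.
- by rewrite [a * _]mulrC [a' * _]mulrC; apply: in_ideal2D; apply: in_ideal2M.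
- have b0 := neq0_eval_at bP; have b0' := neq0_eval_at bP'.
  by rewrite tofracD !tofracM addf_div; [|exact: b0|exact: b0'].
Qed.

Lemma in_local_idealZ (c : K) w : I w -> I (tofrac c%:MP * w).
Proof.
move=> [d [a [b [ha hb bP Ia ->]]]]; exists d, (c%:MP * a), b; split=> //.
- by rewrite mul_mpolyC rpredZ.
- exact: in_ideal2M.
- by rewrite rmorphM mulrA.
Qed.

Lemma in_local_idealN w : I w -> I (- w).
Proof. by move/(in_local_idealZ (-1)); rewrite mpolyCN !rmorphN !rmorph1 mulN1r. Qed.

Lemma in_local_ideal_sum m (x : 'I_m -> {fraction S}) :
  (forall i, I (x i)) -> I (\sum_(i < m) x i).
Proof.
by move=> h; apply: big_ind => //; [exact: in_local_ideal0|exact: in_local_idealD].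
Qed.

Lemma in_local_ring0 : in_local_ring P 0.
Proof.
exists 0%N, 0, 1; split; rewrite ?dhomog0 ?dhomog1 ?rmorph0 ?mul0r //.
by rewrite /eval_at meval1 oner_neq0.
Qed.

(** The coordinates of the [x i] in the given basis form an [m] by [n] matrix; if [n < m], a nonzero
    row vector in its kernel would be a forbidden relation. *)
Lemma intersection_mult_ge m n (x : 'I_m -> {fraction S}) :
  (forall i, in_local_ring P (x i)) ->
  (forall c : 'rV[K]_m, I (\sum_(i < m) tofrac (c 0 i)%:MP * x i) -> c = 0) ->
  intersection_mult F G P n -> (m <= n)%N.
Proof.
move=> hx indep [e [_ he]]; rewrite leqNgt; apply/negP => nm.
have hA (i : 'I_m) : exists r : 'rV[K]_n,
    I (x i - \sum_(j < n) tofrac (r 0 j)%:MP * e j).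
  by have [r [hr _]] := he _ (hx i); exists r.
have [A hA'] := fin_all_exists hA.
pose M : 'M[K]_(m, n) := \matrix_(i, j) A i 0 j.
have : kermx M != 0.
  rewrite kermx_eq0 /row_free; apply: contraTneq (rank_leq_col M) => ->.
  by rewrite -ltnNge.
case/rowV0Pn => c /sub_kermxP cM /negP[]; apply/eqP/indep.
have := in_local_ideal_sum (fun i => in_local_idealZ (c 0 i) (hA' i)).
congr (I _); under eq_bigr => i _ do rewrite mulrBr.
rewrite sumrB; apply/eqP; rewrite subr_eq addrC -subr_eq subrr eq_sym; apply/eqP.
under eq_bigr => i _ do rewrite mulr_sumr.
rewrite exchange_big /= big1 // => j _.
under eq_bigr => i _ do rewrite mulrA -!rmorphM.
rewrite -mulr_suml -!rmorph_sum (_ : \sum_(i < m) _ = (c *m M) 0 j).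
  by rewrite cM mxE !rmorph0 mul0r.
by rewrite mxE; apply: eq_bigr => i _; rewrite mxE.
Qed.

Lemma intersection_mult_indep n : intersection_mult F G P n ->
  exists2 x : 'I_n -> {fraction S}, (forall i, in_local_ring P (x i)) &
  (forall c : 'rV[K]_n, I (\sum_(i < n) tofrac (c 0 i)%:MP * x i) -> c = 0).
Proof.
move=> [e [he hu]]; exists e => // c Ic.
have [c0 [_ uniq]] := hu _ in_local_ring0.
(* The basis property subtracts the combination from the element; for the element 0, the relation
   [c] therefore appears as the coordinates [- c]. *)
transitivity (- - c); first by rewrite opprK.
rewrite -(uniq (- c)).
  rewrite (uniq 0) ?oppr0 // big1 ?subrr; first exact: in_local_ideal0.
  by move=> i _; rewrite mxE !rmorph0 mul0r.
rewrite sub0r -sumrN; move: Ic; congr (I _); apply: eq_bigr => i _.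
by rewrite mxE !rmorphN mulNr opprK.
Qed.

Lemma intersection_mult_uniq m n :
  intersection_mult F G P m -> intersection_mult F G P n -> m = n.
Proof.
move=> hm hn; apply/eqP; rewrite eqn_leq; apply/andP; split.
  have [x hx hi] := intersection_mult_indep hm.
  exact: intersection_mult_ge hx hi hn.
have [x hx hi] := intersection_mult_indep hn.
exact: intersection_mult_ge hx hi hm.
Qed.

(** A form of the ideal that does not vanish at [P] is a local unit and makes the quotient zero,
    which the successor [n.+1] rules out. *)
Lemma intersection_mult_on_curves d d' n : F \is d.-homog -> G \is d'.-homog ->
  intersection_mult F G P n.+1 -> on_curve F P /\ on_curve G P.
Proof.
move=> hF hG hn.
have [x hx hi] := intersection_mult_indep hn.
have unitI H e : H \is e.-homog -> in_ideal [:: F; G] H -> on_curve H P.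
  move=> hH IH; apply/eqP; apply: contraT => HP.
  have/hi/eqP : I (\sum_(i < n.+1)
      tofrac ((const_mx 1 : 'rV[K]_n.+1) 0 i)%:MP * x i).
    apply: in_local_ideal_sum => i; apply: in_local_idealZ.
    have [k [a [b [ha hb bP ->]]]] := hx i.
    exists (k + e)%N, (a * H), (b * H); split; rewrite ?dhomogM //.
    - by rewrite eval_atM mulf_neq0.
    - exact: in_ideal2M.
    - by rewrite !rmorphM -mulf_div divff ?mulr1 // (neq0_eval_at HP).
  move=> /eqP/rowP/(_ 0); rewrite !mxE => /eqP.
  by rewrite oner_eq0.
split; [apply: (unitI _ d) => //|apply: (unitI _ d') => //];
  apply/in_ideal2P; [exists 1, 0|exists 0, 1]; ring.
Qed.

End LocalIdeal.

(** * Curves with a rational parametrization *)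

Section Parametrization.
Variable K : fieldType.
Local Notation S := {mpoly K[3]}.
Implicit Types (F q : S) (p : {poly K}).

Definition pull (g : 'I_3 -> {poly K}) F : {poly K} := mmap polyC g F.
HB.instance Definition _ g := GRing.RMorphism.copy (pull g) (mmap polyC g).

Definition mlift (v : S) p : S := (map_poly (@mpolyC 3 K) p).[v].

Lemma mliftD v p p' : mlift v (p + p') = mlift v p + mlift v p'.
Proof. by rewrite /mlift rmorphD hornerD. Qed.

Lemma mliftB v p p' : mlift v (p - p') = mlift v p - mlift v p'.
Proof. by rewrite /mlift rmorphB hornerD hornerN. Qed.

Lemma mliftM v p p' : mlift v (p * p') = mlift v p * mlift v p'.
Proof. by rewrite /mlift rmorphM hornerM. Qed.

Lemma mliftC v c : mlift v c%:P = c%:MP.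
Proof. by rewrite /mlift map_polyC hornerC. Qed.

Lemma mliftX v : mlift v 'X = v.
Proof. by rewrite /mlift map_polyX hornerX. Qed.

Lemma pullC g c : pull g c%:MP = c%:P.
Proof. exact: mmapC. Qed.

Lemma pullXi g i : pull g 'X_i = g i.
Proof. by rewrite /pull mmapX mmap1U. Qed.

Lemma pullZ g c F : pull g (c *: F) = c *: pull g F.
Proof. by rewrite -mul_mpolyC rmorphM /= pullC mul_polyC. Qed.

Variables (G : S) (dG : nat) (P : 'rV[K]_3) (u v : S) (g : 'I_3 -> {poly K}).

(* [t |-> g t] parametrizes the curve [G = 0] near [P = g 0]; the affine
   coordinate [t] is recovered as [v / u]. *)
Definition local_param : Prop :=
  [/\ G \is dG.-homog, u \is 1.-homog & v \is 1.-homog] /\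
  [/\ pull g u = 1, pull g v = 'X, pull g G = 0,
      forall i, (g i).[0] = P 0 i
    & forall i, exists A B, 'X_i = mlift v (g i) + A * G + B * (u - 1)].

Hypothesis hpar : local_param.

Lemma pull_at0 F : (pull g F).[0] = eval_at F P.
Proof.
have [_ [_ _ _ h0 _]] := hpar; rewrite /eval_at.
move: F; apply: mpoly_ring_ind => [c|i|F q|F q].
- by rewrite pullC hornerC mevalC.
- by rewrite pullXi mevalXU.
- by rewrite rmorphD hornerD mevalD => -> ->.
- by rewrite rmorphM hornerM mevalM => -> ->.
Qed.

(** Together with [pull_mlift], this identifies the coordinate ring of the chart [u = 1] of the
    curve with the polynomials in [t]. *)
Lemma mlift_pull F :
  exists A B, F = mlift v (pull g F) + A * G + B * (u - 1).
Proof.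
have [_ [_ _ _ _ hX]] := hpar.
move: F; apply: mpoly_ring_ind => [c|i|F q|F q].
- by exists 0, 0; rewrite pullC mliftC !mul0r !addr0.
- by rewrite pullXi.
- move=> [A [B hF]] [A' [B' hq]]; exists (A + A'), (B + B').
  rewrite rmorphD mliftD {1}hF {1}hq; ring.
- move=> [A [B hF]] [A' [B' hq]].
  exists (A * q + mlift v (pull g F) * A'), (B * q + mlift v (pull g F) * B').
  rewrite rmorphM mliftM {1}hF mulrDl mulrDl {1}hq; ring.
Qed.

Lemma pull_mlift p : pull g (mlift v p) = p.
Proof.
have [_ [_ hv _ _ _]] := hpar.
elim/poly_ind: p => [|p c IH].
  by rewrite /mlift rmorph0 horner0 rmorph0.
by rewrite mliftD mliftM mliftX mliftC rmorphD rmorphM /= IH hv pullC.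
Qed.

Lemma u_neq0 : tofrac u != 0.
Proof.
have [_ [hu _ _ _ _]] := hpar; rewrite tofrac_eq0.
by apply: contra_eq_neq hu => ->; rewrite rmorph0 eq_sym oner_neq0.
Qed.

Lemma eval_u : eval_at u P = 1.
Proof. by have [_ [hu _ _ _ _]] := hpar; rewrite -pull_at0 hu hornerC. Qed.

(** Dividing the coordinates by [u] sends [u] to 1, so congruences modulo [u - 1] become identities
    between degree-zero fractions. *)
Definition dehom F : {fraction S} :=
  mmap (@FracField.tofrac S \o @mpolyC 3 K) (fun i => tofrac 'X_i / tofrac u) F.
HB.instance Definition _ := GRing.RMorphism.copy dehom
  (mmap (@FracField.tofrac S \o @mpolyC 3 K) (fun i => tofrac 'X_i / tofrac u)).

Lemma dehomC c : dehom c%:MP = tofrac c%:MP.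
Proof. exact: mmapC. Qed.

Lemma dehomXi i : dehom 'X_i = tofrac 'X_i / tofrac u.
Proof. by rewrite /dehom mmapX mmap1U. Qed.

Lemma dehom_homog d F : F \is d.-homog -> tofrac F = tofrac u ^+ d * dehom F.
Proof.
move: F; apply: dhomog_ind => [|F q hF hq|c m <-].
- by rewrite !rmorph0 mulr0.
- by rewrite tofracD rmorphD /= mulrDr -hF -hq.
rewrite -!mul_mpolyC !rmorphM /= dehomC mulrCA; congr (_ * _).
rewrite mpolyXE_id !rmorph_prod mdegE -prodrXr -big_split /=.
apply: eq_bigr => i _; rewrite !rmorphXn /= dehomXi -exprMn.
by rewrite mulrC divfK; [|exact: u_neq0].
Qed.

Lemma dehom_u : dehom u = 1.
Proof.
have [[_ hu _] _] := hpar; have := dehom_homog hu.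
rewrite expr1 -[LHS]mulr1 => /(mulfI u_neq0) h; exact: esym.
Qed.

(** Every sufficiently large degree is offered, so that several polynomials can be homogenized to
    the same degree. *)
Lemma homogenize F : exists n0, forall n, (n0 <= n)%N -> exists F',
  [/\ F' \is n.-homog, tofrac F' = tofrac u ^+ n * dehom F
    & eval_at F' P = eval_at F P].
Proof.
have [[_ hu _] _] := hpar.
have hun k : u ^+ k \is k.-homog by rewrite -[k in k.-homog]mul1n dhomogMn.
have eun k : eval_at (u ^+ k) P = 1.
  by rewrite /eval_at rmorphXn /= -/(eval_at u P) eval_u expr1n.
move: F; apply: mpoly_ring_ind => [c|i|F q [n1 h1] [n2 h2]|F q [n1 h1] [n2 h2]].
- exists 0%N => n _; exists (c%:MP * u ^+ n); split.
  + by rewrite mul_mpolyC rpredZ.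
  + by rewrite dehomC tofracM tofracXn mulrC.
  + by rewrite eval_atM eun mulr1.
- exists 1%N => -[//|n] _; exists ('X_i * u ^+ n); split.
  + by apply: (@dhomogM _ _ _ 1 _ n) => //; rewrite dhomogX /= mdeg1.
  + rewrite dehomXi tofracM tofracXn exprS.
    rewrite [LHS]mulrC (mulrC (tofrac u)) -mulrA; congr (_ * _).
    by rewrite mulrC divfK; [|exact: u_neq0].
  + by rewrite eval_atM eun mulr1.
- exists (n1 + n2)%N => n hn.
  have [|F' [? e1 e2]] := h1 n; first exact: leq_trans (leq_addr _ _) hn.
  have [|q' [? e3 e4]] := h2 n; first exact: leq_trans (leq_addl _ _) hn.
  exists (F' + q'); split; first exact: rpredD.
    by rewrite tofracD rmorphD mulrDr e1 e3.
  by move: e2 e4; rewrite /eval_at !mevalD => -> ->.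
- exists (n1 + n2)%N => n hn.
  have [|F' [? e1 e2]] := h1 n1; first by [].
  have [|q' [? e3 e4]] := h2 (n - n1)%N.
    by rewrite leq_subRL ?(leq_trans (leq_addr n2 n1)).
  have n1n : (n1 + (n - n1) = n)%N by rewrite subnKC // (leq_trans (leq_addr n2 n1)).
  exists (F' * q'); split; first by rewrite -n1n dhomogM.
    by rewrite tofracM rmorphM e1 e3 -[in RHS]n1n exprD mulrACA.
  by rewrite !eval_atM e2 e4.
Qed.

Lemma dehom_mlift_sum n (c : 'I_n -> K) :
  dehom (mlift v (\sum_(k < n) c k *: 'X^k)) =
  \sum_(k < n) tofrac (c k)%:MP * (tofrac v ^+ k / tofrac u ^+ k).
Proof.
have [[_ _ hv] _] := hpar.
have vE : dehom v = tofrac v / tofrac u.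
  have := dehom_homog hv; rewrite expr1 => ->.
  by rewrite mulrC mulKf; [|exact: u_neq0].
rewrite /mlift rmorph_sum /= horner_sum rmorph_sum /=; apply: eq_bigr => k _.
rewrite map_polyZ map_polyXn hornerZ hornerXn rmorphM rmorphXn /=.
by rewrite dehomC vE expr_div_n.
Qed.

Lemma param_local_ring k : in_local_ring P (tofrac v ^+ k / tofrac u ^+ k).
Proof.
have [[_ hu hv] _] := hpar; exists k, (v ^+ k), (u ^+ k); split.
- by rewrite -[k in k.-homog]mul1n dhomogMn.
- by rewrite -[k in k.-homog]mul1n dhomogMn.
- by rewrite /eval_at rmorphXn /= -/(eval_at u P) eval_u expr1n oner_neq0.
- by rewrite !tofracXn.
Qed.

(** Pulled back to the line, the relation says that ['X^m] divides the polynomial with coefficients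
    [c] times the pullback of [b]. The latter is nonzero at 0, so ['X^m] divides a polynomial of
    size at most [m], which must vanish. *)
Lemma param_indep q m p (c : 'rV[K]_m) :
  pull g q = 'X^m * p ->
  in_local_ideal [:: q; G] P
    (\sum_(k < m) tofrac (c 0 k)%:MP * (tofrac v ^+ k / tofrac u ^+ k)) ->
  c = 0.
Proof.
have [_ [hu hv hG _ _]] := hpar.
move=> hq [d [a [b [_ _ bP /in_ideal2P[A [B aE]] E]]]].
pose C := \sum_(k < m) (c 0 k)%:MP * (v ^+ k * u ^+ (m - k)).
have CE : C * b = u ^+ m * a.
  have b0 := neq0_eval_at bP.
  apply/eqP; rewrite -tofrac_eq !tofracM tofracXn; apply/eqP.
  have -> : tofrac a = tofrac a / tofrac b * tofrac b.
    by rewrite divfK; [|exact: b0].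
  rewrite mulrA -E mulr_sumr /C rmorph_sum /=; congr (_ * _).
  apply: eq_bigr => k _; rewrite !tofracM !tofracXn [RHS]mulrCA; congr (_ * _).
  rewrite [RHS]mulrCA; congr (_ * _).
  have hk : (k <= m)%N by apply: ltnW.
  have -> : tofrac u ^+ m = tofrac u ^+ (m - k) * tofrac u ^+ k.
    by rewrite -exprD subnK.
  by rewrite mulfK; [|apply: expf_neq0; exact: u_neq0].
have pC : pull g C = rVpoly c.
  rewrite /rVpoly poly_def rmorph_sum /=; apply: eq_bigr => k _.
  by rewrite !rmorphM !rmorphXn /= hu hv pullC expr1n mulr1 mul_polyC valK.
have := congr1 (pull g) CE.
rewrite aE !(rmorphM, rmorphD) rmorphXn /= pC hu hG expr1n mul1r hq mulr0 addr0.
move=> pE.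
have dvd : 'X^m %| rVpoly c.
  rewrite -(@Gauss_dvdpl _ _ (pull g b)); first by rewrite pE -mulrCA dvdp_mulr.
  by rewrite coprimep_expl // coprimep_sym coprimepX rootE pull_at0.
have c0 : rVpoly c = 0.
  apply/eqP; apply: contraT => /dvdp_leq/(_ dvd).
  by rewrite size_polyXn ltnNge size_poly.
by rewrite -(rVpolyK c) c0 linear0.
Qed.

Lemma param_mult_ge q m p n :
  pull g q = 'X^m * p -> intersection_mult q G P n -> (m <= n)%N.
Proof.
move=> hq; apply: intersection_mult_ge (fun i : 'I_m => param_local_ring i) _.
by move=> c; apply: param_indep hq.
Qed.

Lemma dehom_in_local_ideal q d A B b :
  q \is d.-homog -> eval_at b P != 0 ->
  in_local_ideal [:: q; G] P ((dehom A * dehom q + dehom B * dehom G) / dehom b).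
Proof.
move=> hq bP; have [[hG hu _] _] := hpar.
have [nA hA] := homogenize A; have [nB hB] := homogenize B.
have [nb hb] := homogenize b; pose n := (nA + nB + nb)%N.
have [|A' [dA eA _]] := hA n; first by rewrite /n -addnA leq_addr.
have [|B' [dB eB _]] := hB n; first by rewrite /n addnAC leq_addl.
have [|b' [db eb evb]] := hb n; first by rewrite /n leq_addl.
have hun k : u ^+ k \is k.-homog by rewrite -[k in k.-homog]mul1n dhomogMn.
(* The powers of [u] bring both products and the denominator to one degree; they cancel in the
   fraction. *)
exists (n + d + dG)%N, (A' * q * u ^+ dG + B' * G * u ^+ d), (b' * u ^+ (d + dG)).
split.
- by apply: rpredD; [|rewrite addnAC]; rewrite !dhomogM.
- by rewrite -addnA dhomogM.
- by rewrite eval_atM evb /eval_at rmorphXn /= -/(eval_at u P) eval_u expr1n mulr1.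
- apply/in_ideal2P; exists (A' * u ^+ dG), (B' * u ^+ d).
  by rewrite ![_ * _ * u ^+ _]mulrAC.
have un0 k : tofrac u ^+ k != 0 by apply: expf_neq0; exact: u_neq0.
rewrite tofracD !tofracM !tofracXn eA eB eb (dehom_homog hq) (dehom_homog hG).
have -> : tofrac u ^+ n * dehom A * (tofrac u ^+ d * dehom q) * tofrac u ^+ dG +
   tofrac u ^+ n * dehom B * (tofrac u ^+ dG * dehom G) * tofrac u ^+ d =
   (tofrac u ^+ n * tofrac u ^+ (d + dG)) * (dehom A * dehom q + dehom B * dehom G).
  by rewrite exprD; ring.
rewrite (mulrAC _ (dehom b)) -mulf_div divff ?mul1r; [by []|].
by apply: mulf_neq0; exact: un0.
Qed.

Lemma dehom_neq0 b : eval_at b P != 0 -> dehom b != 0.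
Proof.
have [n0 /(_ n0 (leqnn _)) [b' [_ e ev]]] := homogenize b.
rewrite -ev => /neq0_eval_at; rewrite e.
by apply: contra_neq => ->; rewrite mulr0.
Qed.

Lemma eval_mlift p : eval_at (mlift v p) P = p.[0].
Proof. by rewrite -pull_at0 pull_mlift. Qed.

(** Independence is [param_indep]. For generation, [a / b] is reduced to the polynomial of size at
    most [n] that represents it modulo ['X^n]; the error is a multiple of ['X^n], hence of [q],
    because [p] is a local unit. *)
Lemma param_mult q d n p : q \is d.-homog -> pull g q = 'X^n * p -> p.[0] != 0 ->
  intersection_mult q G P n.
Proof.
move=> hq pq p0.
exists (fun k => tofrac v ^+ k / tofrac u ^+ k); split.
  by move=> k; apply: param_local_ring.
move=> w [e [a [b [ha hb bP ->]]]].
suff [c hc] : exists c : 'rV[K]_n, in_local_ideal [:: q; G] P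
    (tofrac a / tofrac b -
     \sum_(k < n) tofrac (c 0 k)%:MP * (tofrac v ^+ k / tofrac u ^+ k)).
  exists c; split=> // c' hc'; apply/eqP; rewrite -subr_eq0; apply/eqP.
  apply: (param_indep pq); have := in_local_idealD hc' (in_local_idealN hc).
  rewrite opprB addrC addrA subrK.
  congr (in_local_ideal _ _ _); rewrite -sumrB; apply: eq_bigr => k _.
  by rewrite !mxE mpolyCB tofracB mulrBl.
(* The denominator is nonzero at 0, so a Bezout coefficient [x] inverts it modulo ['X^n]. *)
have cop : coprimep (pull g b) 'X^n.
  by rewrite coprimep_sym coprimep_expl // coprimep_sym coprimepX rootE pull_at0.
have [[x y] /= xy] := Bezout_eq1_coprimepP _ _ cop.
pose r := (pull g a * x) %% 'X^n.
have Xn0 : 'X^n != 0 :> {poly K} by rewrite monic_neq0 // monicXn.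
have [t rt] : exists t, pull g a - r * pull g b = 'X^n * t.
  exists (pull g a * y + (pull g a * x) %/ 'X^n * pull g b).
  have := divp_eq (pull g a * x) 'X^n; rewrite -/r => /(canLR (addKr _)) <-.
  rewrite -[X in X - _]mulr1 -xy; ring.
have sr : (size r <= n)%N by rewrite -ltnS -(size_polyXn K n) ltn_modp.
exists (poly_rV r).
have -> : \sum_(k < n) tofrac (poly_rV r 0 k)%:MP * (tofrac v ^+ k / tofrac u ^+ k)
   = dehom (mlift v r).
  rewrite -dehom_mlift_sum; congr (dehom (mlift v _)).
  rewrite -[RHS](poly_rV_K sr) /rVpoly poly_def.
  by apply: eq_bigr => k _; rewrite valK.
have [A1 [B1 aE]] := mlift_pull a; have [A2 [B2 bE]] := mlift_pull b.
have [A3 [B3 qE]] := mlift_pull q.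
(* Multiplying by [p] turns the error ['X^n * t] into [t] times the pullback of [q], avoiding
   division. *)
have [A [B key]] : exists A B,
    mlift v p * (a - mlift v r * b) = mlift v t * q + A * G + B * (u - 1).
  exists (mlift v p * A1 - mlift v p * mlift v r * A2 - mlift v t * A3).
  exists (mlift v p * B1 - mlift v p * mlift v r * B2 - mlift v t * B3).
  have ptE : mlift v p * (mlift v (pull g a) - mlift v r * mlift v (pull g b))
      = mlift v t * mlift v (pull g q).
    by rewrite -(mliftM v r) -mliftB rt pq !mliftM; ring.
  apply/eqP; rewrite -subr_eq0 {1}aE {1}bE {1}qE; apply/eqP.
  transitivity (mlift v p * (mlift v (pull g a) - mlift v r * mlift v (pull g b))
    - mlift v t * mlift v (pull g q)); last by rewrite ptE subrr.
  ring.
have := congr1 dehom key.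
rewrite !(rmorphB, rmorphD, rmorphM) /= dehom_u rmorph1 subrr mulr0 addr0 => E.
have b0 := dehom_neq0 bP.
have p0' : dehom (mlift v p) != 0 by apply: dehom_neq0; rewrite eval_mlift.
have -> : tofrac a / tofrac b - dehom (mlift v r) =
   (dehom (mlift v t) * dehom q + dehom A * dehom G) / dehom (mlift v p * b).
  rewrite (dehom_homog ha) (dehom_homog hb) -mulf_div divff; last first.
    by apply: expf_neq0; exact: u_neq0.
  rewrite mul1r -E rmorphM /= -mulf_div divff ?mul1r; [|exact: p0'].
  by rewrite mulrBl mulfK; [|exact: b0].
by apply: (dehom_in_local_ideal _ _ hq); rewrite eval_atM eval_mlift mulf_neq0.
Qed.

End Parametrization.

(** * The cubic determines the conic *)

Section Uniqueness.
Variable K : numFieldType.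
Local Notation S := {mpoly K[3]}.
Local Notation X := (fun i : 'I_3 => 'X_i : S).
Implicit Types (F G q f l : S) (a b : 'I_3 -> K).

Lemma cross_eq0_proportional a b :
  (forall i, cross a b i = 0) -> (exists i, b i != 0) ->
  exists k, forall i, a i = k * b i.
Proof.
move=> h [j bj]; exists (a j / b j) => i; apply: (mulIf bj).
rewrite mulrAC divfK //; have [E0 E1 E2] := crossE a b.
move: (h 0) (h 1) (h 2%:R); rewrite E0 E1 E2.
move=> /subr0_eq h12 /subr0_eq h20 /subr0_eq h01.
by case: (ord3P i) => ->; case: (ord3P j) => ->.
Qed.

(** The right-hand side has a quadratic form of rank at most 2, while that of [Qiso] is the
    identity; the two 3 by 3 determinants are 0 and 1. *)
Lemma Qiso_rank a b (c d : K) : Qiso = c *: lin a ^+ 2 + d *: lin b ^+ 2 -> False.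
Proof.
move=> E.
have e i j : c * a i * a j + d * b i * b j = (i == j)%:R.
  have inj (x y : K) : x%:MP *+ 2 = y%:MP *+ 2 :> S -> x = y.
    move=> /eqP; rewrite -!mpolyCMn mpolyC_eq -subr_eq0 -mulrnBl mulrn_eq0 /=.
    by rewrite subr_eq0 => /eqP.
  apply: inj.
  have := congr1 (mderiv j \o mderiv i) E; rewrite /= mderiv_Qiso.
  rewrite mderivMn mderivXi -!mul_mpolyC !expr2.
  rewrite !(mderivM, mderivD, mderiv_mulC, mderiv_lin, mderivC) => h.
  by rewrite mpolyCD !mpolyCM mpolyC_nat h; ring.
have: (1 : K) = 0.
  transitivity ((c * a 0 * a 0 + d * b 0 * b 0) *
    ((c * a 1 * a 1 + d * b 1 * b 1) * (c * a 2%:R * a 2%:R + d * b 2%:R * b 2%:R)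
     - (c * a 1 * a 2%:R + d * b 1 * b 2%:R) ^+ 2)
    - (c * a 0 * a 1 + d * b 0 * b 1) *
    ((c * a 0 * a 1 + d * b 0 * b 1) * (c * a 2%:R * a 2%:R + d * b 2%:R * b 2%:R)
     - (c * a 1 * a 2%:R + d * b 1 * b 2%:R) * (c * a 0 * a 2%:R + d * b 0 * b 2%:R))
    + (c * a 0 * a 2%:R + d * b 0 * b 2%:R) *
    ((c * a 0 * a 1 + d * b 0 * b 1) * (c * a 1 * a 2%:R + d * b 1 * b 2%:R)
     - (c * a 1 * a 1 + d * b 1 * b 1) * (c * a 0 * a 2%:R + d * b 0 * b 2%:R))).
    by rewrite !e /=; ring.
  ring.
by apply/eqP; rewrite oner_eq0.
Qed.

Lemma pencil_eq0 a (c m : K) : lin a != 0 ->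
  c *: Qiso + m *: lin a ^+ 2 = 0 -> c = 0 /\ m = 0.
Proof.
move=> a0 E; have [c0|c0] := eqVneq c 0.
  split=> //; move/eqP: E; rewrite c0 scale0r add0r.
  by rewrite -mul_mpolyC mulf_eq0 mpolyC_eq0 expf_eq0 (negPf a0) orbF => /eqP.
case: (@Qiso_rank a a (- (m / c)) 0); apply: (scalerI c0).
rewrite scale0r addr0 scalerA mulrN mulrC divfK // scaleNr.
by apply/eqP; rewrite -addr_eq0 E.
Qed.

Lemma cubic_minors a (c m : K) i :
  cross X (fun j => (lin a * (c *: Qiso + m *: lin a ^+ 2))^`M(j)) i =
  (c *: Qiso + (3%:R * m) *: lin a ^+ 2) * cross X (fun j => (a j)%:MP) i.
Proof.
have h j : (lin a * (c *: Qiso + m *: lin a ^+ 2))^`M(j) =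
    (a j)%:MP * (c *: Qiso + (3%:R * m) *: lin a ^+ 2)
    + 'X_j * (c%:MP * lin a *+ 2).
  rewrite -!mul_mpolyC mpolyCM rmorph_nat expr2.
  rewrite !(mderivM, mderivD, mderiv_mulC) !mderivC mderiv_lin mderiv_Qiso; ring.
rewrite /cross !h; ring.
Qed.

Theorem eigenscheme_conic_unique q a (c m : K) :
  is_form 2 q -> is_form 3 (lin a * (c *: Qiso + m *: lin a ^+ 2)) ->
  curve_in_eigenscheme q (lin a * (c *: Qiso + m *: lin a ^+ 2)) ->
  same_curve q (c *: Qiso + (3%:R * m) *: lin a ^+ 2).
Proof.
set f := lin a * _ => hq hf hqf.
have [b [c' [m' [b0 qE fE]]]] := eigenscheme_conic hq hf hqf.
have a0 : lin a != 0 by apply: contra_neq hf.2; rewrite /f => ->; rewrite mul0r.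
set p := c *: Qiso + _.
have E i : p * cross X (fun j => (a j)%:MP) i
         = q * cross X (fun j => (b j)%:MP) i.
  rewrite -cubic_minors -/f fE cubic_minors qE.
  by rewrite [3%:R * _]mulrC divfK // pnatr_eq0.
(* Dotting [E] with [a] kills the left side and leaves [q] times the triple product of [X], [b],
   [a]. *)
have ba : lin (cross b a) = 0.
  apply: (mulfI hq.2); rewrite mulr0.
  transitivity (p * dot (cross X (fun j => (a j)%:MP)) (fun j => (a j)%:MP)).
    transitivity (q * dot (cross X (fun j => (b j)%:MP)) (fun j => (a j)%:MP)).
      2: by rewrite /dot !mulr_sumr; apply: eq_bigr => i _; rewrite !mulrA E.
    rewrite linE /dot !sum3; have [-> -> ->] := crossE b a.
    have [-> -> ->] := crossE X (fun j => (b j)%:MP).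
    rewrite !mpolyCB !mpolyCM; ring.
  by rewrite dotC dot_crossr mulr0.
have [k bk] := cross_eq0_proportional (lin_eq0 ba) (lin_neq0 a0).
have k0 : k != 0.
  apply: contra_neq b0 => k0; rewrite /lin big1 // => i _.
  by rewrite bk k0 mul0r scale0r.
have [j aj] : exists j, cross X (fun i => (a i)%:MP) j != 0.
  apply/existsP; apply: contraNT a0; rewrite negb_exists => /forallP h.
  have {}h i : cross X (fun i => (a i)%:MP) i = 0.
    by apply/eqP; have := h i; rewrite negbK.
  have [E0 E1 E2] := crossE X (fun i => (a i)%:MP).
  move: (h 0) (h 1) (h 2%:R); rewrite E0 E1 E2 => h0 h1 h2.
  have d0 := congr1 (mderiv 1) h0; have d1 := congr1 (mderiv 2%:R) h1.
  have d2 := congr1 (mderiv 0) h2.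
  move: d0 d1 d2; rewrite !mderivB !mderivM !mderivC !mderivXi ?mderiv0.
  rewrite /= !mulr0 !mul0r !addr0 !mul1r !subr0 => d0 d1 d2.
  by rewrite linE /dot sum3 d0 d1 d2 !mulr0 !addr0.
exists k^-1; first by rewrite invr_eq0.
apply: (scalerI k0); rewrite scalerA divff // scale1r.
apply: (mulIf aj); rewrite E -scalerAl scalerAr; congr (_ * _).
by rewrite -mul_mpolyC /cross !bk !mpolyCM; ring.
Qed.

End Uniqueness.

(** * The isotropic conic *)

Section Conic.
Variable K : numFieldType.
Local Notation S := {mpoly K[3]}.
Local Notation X := (fun i : 'I_3 => 'X_i : S).
Implicit Types (a p r : 'I_3 -> K) (P : 'rV[K]_3).

Definition conic_path p r : 'I_3 -> {poly K} :=
  fun i => (p i)%:P + (cross p r i)%:P * 'X + (r i / 2%:R)%:P * 'X ^+ 2.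

Lemma pull_lin p r a :
  pull (conic_path p r) (lin a) = (dot a p)%:P + (dot a (cross p r))%:P * 'X
    + (dot a r / 2%:R)%:P * 'X ^+ 2.
Proof.
rewrite linE rmorph_dot /dot !sum3 /= !pullXi !pullC /conic_path.
rewrite !(rmorphD, rmorphM) /=; ring.
Qed.

(** In the frame [p], [N = cross p r], [r], put [u = X . r], [v = - X . N], [w = X . p]. Then
    [X = u p + v N + w r] and [Q = 2 u w - v^2], so [w = v^2 / 2] on the conic where [u = 1]. The
    sign of [v] compensates [N . N = -1]. *)
Lemma conic_local_param P r :
  let p := fun i => P 0 i in
  dot p p = 0 -> dot r r = 0 -> dot p r = 1 ->
  local_param Qiso 2 P (lin r) (lin (fun i => - cross p r i)) (conic_path p r).
Proof.
move=> p pp rr pr.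
have n2 : 2%:R != 0 :> K by rewrite pnatr_eq0.
have NN : dot (cross p r) (cross p r) = -1.
  by rewrite dot_cross_cross pp rr pr mul0r expr1n sub0r.
have dN a : dot (fun i => - cross p r i) a = - dot (cross p r) a.
  by rewrite /dot -sumrN; apply: eq_bigr => i _; rewrite mulNr.
split; [split|split].
- exact: Qiso_homog.
- exact: lin_homog.
- exact: lin_homog.
- by rewrite pull_lin (dotC r p) pr dot_crossr rr !(mul0r, polyC0, addr0).
- rewrite pull_lin !dN NN (dotC _ p) dot_crossl (dotC _ r) dot_crossr.
  by rewrite oppr0 opprK !(mul0r, polyC0, addr0, add0r, mul1r).
- rewrite Qiso_dot rmorph_dot.
  transitivity (dot (conic_path p r) (conic_path p r)).
    by apply: eq_bigr => i _; rewrite /= pullXi.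
  transitivity ((dot p p)%:P + (dot p (cross p r))%:P * 'X *+ 2
     + (dot p r * 2%:R^-1 *+ 2 + dot (cross p r) (cross p r))%:P * 'X ^+ 2
     + (dot r (cross p r) * 2%:R^-1 *+ 2)%:P * 'X ^+ 3
     + (dot r r * (2%:R^-1 ^+ 2))%:P * 'X ^+ 4).
    rewrite /dot !sum3 /conic_path !(polyCD, polyCMn, polyCM, rmorphXn) /=; ring.
  rewrite pp dot_crossl pr dot_crossr rr NN !mul0r !mul0rn mul1r.
  rewrite -[2%:R^-1 *+ 2]mulr_natr mulVf // subrr !polyC0; ring.
- by move=> i; rewrite /conic_path !hornerE /= !mulr0 addr0.
move=> i; pose Cp := fun i => (p i)%:MP : S; pose Cr := fun i => (r i)%:MP : S.
have cE j : (cross p r j)%:MP = cross Cp Cr j :> S.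
  by rewrite /cross mpolyCB !mpolyCM.
have dE a b : (dot a b)%:MP = dot (fun i => (a i)%:MP) (fun i => (b i)%:MP) :> S.
  by rewrite (rmorph_dot (@mpolyC 3 K)).
have vE : lin (fun i => - cross p r i) = - dot X (cross Cp Cr).
  rewrite linE /dot -sumrN; apply: eq_bigr => j _.
  by rewrite mpolyCN cE mulrN.
have e1 : dot Cp Cp = 0 by rewrite -dE pp mpolyC0.
have e2 : dot Cr Cr = 0 by rewrite -dE rr mpolyC0.
have e3 : dot Cp Cr = 1 by rewrite -dE pr mpolyC1.
have h2' : (2%:R^-1)%:MP *+ 2 = 1 :> S.
  by rewrite -mpolyCMn -[2%:R^-1 *+ 2]mulr_natr mulVf.
set v := lin _; set u := lin r; pose w := dot X Cp.
have uE : u = dot X Cr by rewrite /u linE.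
exists ((r i / 2%:R)%:MP), ((p i)%:MP - w * (r i)%:MP).
rewrite /conic_path !mliftD !mliftM !mliftX !mliftC cE Qiso_dot.
rewrite (isotropic_norm X e1 e2 e3) -uE -/w.
rewrite [LHS](isotropic_expand X i e1 e2 e3) -uE -/w.
have -> : dot X (cross Cp Cr) = - v by rewrite /v vE opprK.
rewrite mpolyCM -/(Cp i) -/(Cr i).
transitivity (u * Cp i + v * cross Cp Cr i + w * Cr i
  + ((2%:R^-1)%:MP *+ 2 - 1) * (u * w * Cr i)); first by rewrite h2'; ring.
ring.
Qed.

End Conic.

(** * Multiplicities along secants and tangents of the isotropic conic *)

Section ConicMultiplicity.
Variable K : numClosedFieldType.
Local Notation S := {mpoly K[3]}.
Implicit Types (q : S) (a : 'I_3 -> K) (P : 'rV[K]_3).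
Local Notation coord P := (fun i : 'I_3 => P 0 i).

Lemma eval_lin a P : eval_at (lin a) P = dot a (coord P).
Proof.
rewrite /eval_at /lin rmorph_sum /=; apply: eq_bigr => i _.
by rewrite mevalZ mevalXU.
Qed.

Lemma eval_Qiso P : eval_at Qiso P = dot (coord P) (coord P).
Proof.
rewrite /eval_at /Qiso rmorph_sum /=; apply: eq_bigr => i _.
by rewrite rmorphXn /= mevalXU.
Qed.

Lemma row_neq0 P : P != 0 -> exists i, P 0 i != 0.
Proof.
move=> P0; apply/existsP; apply: contraNT P0.
rewrite negb_exists => /forallP h; apply/eqP/rowP => i; rewrite mxE.
by have := h i; rewrite negbK => /eqP.
Qed.

Lemma isotropic_dual P : P != 0 -> dot (coord P) (coord P) = 0 ->
  exists r : 'I_3 -> K, dot r r = 0 /\ dot (coord P) r = 1.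
Proof.
(* The witness is the normalized complex conjugate of [P]. *)
move=> /row_neq0[k Pk] PP; pose h := \sum_(i < 3) P 0 i * (P 0 i)^*.
have h0 : h != 0.
  rewrite psumr_neq0 => [|i _]; last exact: mul_conjC_ge0.
  by apply/hasP; exists k; rewrite ?mem_index_enum // mul_conjC_gt0.
exists (fun i => (P 0 i)^* / h); split.
  transitivity ((dot (coord P) (coord P))^* / h ^+ 2).
    rewrite rmorph_sum mulr_suml; apply: eq_bigr => i _.
    by rewrite rmorphM /= mulf_div expr2.
  by rewrite PP rmorph0 mul0r.
by rewrite /dot; under eq_bigr => i _ do rewrite mulrA; rewrite -mulr_suml divff.
Qed.

(** In an isotropic frame at [P], a vector orthogonal to [P] has norm [- (a . N)^2]; if this
    vanishes, only the component along [P] is left. Geometrically, a line through [P] tangent to the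
    conic is the tangent at [P]. *)
Lemma isotropic_orthogonal a P :
  P != 0 -> dot (coord P) (coord P) = 0 -> dot a (coord P) = 0 ->
  dot a a = 0 -> exists k, forall i, a i = k * P 0 i.
Proof.
move=> P0 PP aP aa; have [r [rr pr]] := isotropic_dual P0 PP.
exists (dot a r) => i; rewrite {1}(isotropic_expand a i PP rr pr) aP.
have := isotropic_norm a PP rr pr; rewrite aa aP mulr0 mul0rn sub0r.
move=> /esym/eqP; rewrite oppr_eq0 expf_eq0 /= => /eqP ->.
by rewrite !mul0r addr0 subr0.
Qed.

Lemma pencil_homog a (c m : K) : c *: Qiso + m *: lin a ^+ 2 \is 2.-homog.
Proof.
apply: rpredD; apply: rpredZ; first exact: Qiso_homog.
exact: (dhomogMn 2 (lin_homog a)).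
Qed.

Lemma pull_Qiso P r :
  dot (coord P) (coord P) = 0 -> dot r r = 0 -> dot (coord P) r = 1 ->
  pull (conic_path (coord P) r) Qiso = 0.
Proof. by move=> PP rr pr; have [_ []] := conic_local_param PP rr pr. Qed.

Lemma mult_secant a (c m : K) P : P != 0 -> m != 0 ->
  on_curve Qiso P -> on_curve (lin a) P -> dot a a != 0 ->
  intersection_mult (c *: Qiso + m *: lin a ^+ 2) Qiso P 2.
Proof.
rewrite /on_curve eval_lin eval_Qiso => P0 m0 PP aP aa.
have [r [rr pr]] := isotropic_dual P0 PP.
pose N := cross (coord P) r.
apply: (param_mult (conic_local_param PP rr pr) (pencil_homog a c m)
  (p := m%:P * ((dot a N)%:P + (dot a r / 2%:R)%:P * 'X) ^+ 2)).
  rewrite rmorphD /= !pullZ pull_Qiso // rmorphXn /= pull_lin aP polyC0.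
  rewrite -!mul_polyC /N; ring.
(* On the line through [P] the norm of [a] is [- (a . N)^2], so a secant has a nonzero linear term
   in [t]. *)
have aN0 : dot a N != 0.
  apply: contra_neq aa => aN.
  by rewrite (isotropic_norm a PP rr pr) aP aN mulr0 mul0rn expr0n subrr.
by rewrite !hornerE /= !mulf_neq0.
Qed.

Lemma mult_tangent a (c m k : K) P : P != 0 -> m != 0 -> k != 0 ->
  on_curve Qiso P -> (forall i, a i = k * P 0 i) ->
  intersection_mult (c *: Qiso + m *: lin a ^+ 2) Qiso P 4.
Proof.
rewrite /on_curve eval_Qiso => P0 m0 k0 PP aE.
have [r [rr pr]] := isotropic_dual P0 PP.
have aD b : dot a b = k * dot (coord P) b.
  by rewrite /dot mulr_sumr; apply: eq_bigr => i _; rewrite aE mulrA.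
apply: (param_mult (conic_local_param PP rr pr) (pencil_homog a c m)
  (p := m%:P * (k / 2%:R)%:P ^+ 2)).
  rewrite rmorphD /= !pullZ pull_Qiso // rmorphXn /= pull_lin !aD PP dot_crossl pr.
  rewrite mulr0 mulr1 polyC0 mul0r !add0r -!mul_polyC; ring.
by rewrite !hornerE /= !mulf_neq0 // invr_eq0 pnatr_eq0.
Qed.

(** The pullback is zero, hence divisible by ['X^n.+1], which would force [n.+1 <= n]. *)
Lemma mult_Qiso (c : K) P n : P != 0 -> on_curve Qiso P ->
  ~ intersection_mult (c *: Qiso) Qiso P n.
Proof.
rewrite /on_curve eval_Qiso => P0 PP; have [r [rr pr]] := isotropic_dual P0 PP.
move/(param_mult_ge (conic_local_param PP rr pr) (m := n.+1) (p := 0)).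
by rewrite ltnn pullZ pull_Qiso // scaler0 mulr0 => /(_ erefl).
Qed.

End ConicMultiplicity.

(** * The three cases *)

Section Classification.
Variable K : numClosedFieldType.
Local Notation S := {mpoly K[3]}.
Implicit Types (q f r : S) (a : 'I_3 -> K) (P : 'rV[K]_3).
Local Notation coord P := (fun i : 'I_3 => P 0 i).

Lemma distinct_pointsP P1 P2 k :
  P1 != 0 -> distinct_points P1 P2 -> P1 = k *: P2 -> False.
Proof.
move=> P10 + E; rewrite /distinct_points E => /negP; apply.
have k0 : k != 0 by apply: contra_neq P10 => k0; rewrite E k0 scale0r.
by apply/eqmxP/eqmx_scale.
Qed.

Lemma distinct_pointsI P1 P2 :
  (forall k, P1 = k *: P2 -> False) -> distinct_points P1 P2.
Proof. by move=> h; apply/negP => /andP[/sub_rVP[k /h]]. Qed.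

(** With [b] orthogonal to [a] and [c = cross a b], the points are [s b + c] and [s b - c], where
    [s^2 = - a . a]: since [c . c = (a . a) (b . b)], both are isotropic. *)
Lemma secant_line_points a : dot a a != 0 -> exists P1 P2 : 'rV[K]_3,
  [/\ P1 != 0, P2 != 0, distinct_points P1 P2,
      on_curve Qiso P1 /\ on_curve Qiso P2
    & on_curve (lin a) P1 /\ on_curve (lin a) P2].
Proof.
move=> aa; pose e i : 'I_3 -> K := fun j => (j == i)%:R.
(* The norm of [cross (e i) a] is [a . a - a_i^2]; if all three vanished, summing would give
   [a . a = 3 (a . a)]. *)
have [i bb] : exists i, dot (cross (e i) a) (cross (e i) a) != 0.
  apply/existsP; apply: contraNT aa; rewrite negb_exists => /forallP h.
  have {}h i : dot a a = a i ^+ 2.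
    have := h i; rewrite negbK dot_cross_cross subr_eq0 => /eqP.
    have -> : dot (e i) a = a i.
      rewrite /dot (bigD1 i) //= /e eqxx mul1r big1 ?addr0 // => j /negPf ->.
      by rewrite mul0r.
    rewrite /dot (bigD1 i) //= /e eqxx !mul1r big1 ?addr0 ?mul1r // => j /negPf ->.
    by rewrite mul0r.
  have E : dot a a = dot a a *+ 3.
    by rewrite {1}/dot sum3 -!expr2 -!h; ring.
  have : dot a a *+ 2 = 0.
    by apply: (addrI (dot a a)); rewrite addr0 [RHS]E; ring.
  by move/eqP; rewrite mulrn_eq0.
set b := cross (e i) a in bb *.
have ab : dot a b = 0 by rewrite dot_crossr.
pose s := sqrtC (- dot a a).
have s2 : s ^+ 2 = - dot a a by rewrite sqrtCK.
have s0 : s != 0 by rewrite sqrtC_eq0 oppr_eq0.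
pose c := cross a b.
have ac : dot a c = 0 by rewrite dot_crossl.
have bc : dot b c = 0 by rewrite dot_crossr.
have cc : dot c c = dot a a * dot b b by rewrite dot_cross_cross ab expr0n subr0.
pose T (t : K) : 'rV[K]_3 := \row_j (s * b j + t * c j).
have dT d t : dot d (coord (T t)) = s * dot d b + t * dot d c.
  rewrite /dot !mulr_sumr -big_split /=; apply: eq_bigr => j _.
  by rewrite mxE; ring.
have bT t : dot b (coord (T t)) = s * dot b b by rewrite dT bc mulr0 addr0.
have T0 t : T t != 0.
  apply/eqP => Tt; have := bT t; rewrite Tt /dot big1 => [|j _].
    by move/esym/eqP; rewrite mulf_eq0 (negPf s0) (negPf bb).
  by rewrite mxE mulr0.
have QT t : t ^+ 2 = 1 -> on_curve Qiso (T t).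
  move=> t2; rewrite /on_curve eval_Qiso dT !(dotC (coord _)) !dT.
  rewrite bc (dotC c b) bc cc.
  transitivity (s ^+ 2 * dot b b + t ^+ 2 * (dot a a * dot b b)); first ring.
  by rewrite s2 t2; ring.
have lT t : on_curve (lin a) (T t).
  by rewrite /on_curve eval_lin dT ab ac !mulr0 addr0.
have cc0 : dot c c != 0 by rewrite cc mulf_neq0.
exists (T 1), (T (-1)); split=> //.
  apply: distinct_pointsI => k E.
  have kd d : dot d (coord (T 1)) = k * dot d (coord (T (-1))).
    rewrite /dot mulr_sumr; apply: eq_bigr => j _.
    by move/rowP/(_ j): E => ->; rewrite mxE; ring.
  have := kd b; rewrite !bT -[LHS]mul1r => /(mulIf _) k1.
  have {}k1 : 1 = k by apply: k1; rewrite mulf_neq0.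
  have := kd c; rewrite !dT -k1 mul1r (dotC c b) bc mulr0 !add0r mulN1r mul1r.
  move/eqP; rewrite -addr_eq0 -mulr2n mulrn_eq0 (negPf cc0).
  by [].
by split; apply: QT; rewrite ?sqrrN expr1n.
Qed.

Section Cubic.
Variables q f : S.
Hypotheses (hq : is_form 2 q) (hf : is_form 3 f)
  (hqf : curve_in_eigenscheme q f).

Lemma form1_lin r : is_form 1 r -> exists2 a, r = lin a & lin a != 0.
Proof. by move=> [/homog_lin[a ->] h]; exists a. Qed.

Lemma conic_of_cubic r (c m : K) : r \is 1.-homog ->
  f = r * (c *: Qiso + m *: r ^+ 2) ->
  same_curve q (c *: Qiso + (3%:R * m) *: r ^+ 2).
Proof.
move=> /homog_lin[a ->] fE; move: hf hqf; rewrite fE => hf' hqf'.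
exact: eigenscheme_conic_unique.
Qed.

Lemma hyperosculating_or_bitangent :
  [\/ same_curve q Qiso,
      exists P1 P2 : 'rV[K]_3,
        [/\ P1 != 0, P2 != 0, distinct_points P1 P2 & bitangent_Qiso q P1 P2]
    | exists2 P : 'rV[K]_3, P != 0 & hyperosculating_Qiso q P].
Proof.
have [a [c [m [a0 qE _]]]] := eigenscheme_conic hq hf hqf.
have [m0|m0] := eqVneq m 0.
  constructor 1; exists c; last by rewrite qE m0 scale0r addr0.
  by apply: contra_neq hq.2; rewrite qE m0 scale0r addr0 => ->; rewrite scale0r.
have [aa|aa] := eqVneq (dot a a) 0.
  (* The conic is its own dual under [dot]: an isotropic line [a] touches it at the point with
     coordinates [a]. *)
  constructor 3; pose P : 'rV[K]_3 := \row_i a i.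
  have aP i : a i = 1 * P 0 i by rewrite mxE mul1r.
  have P0 : P != 0.
    have [i ai] := lin_neq0 a0; apply: contra_neq ai => P0.
    by rewrite aP P0 mxE mulr0.
  exists P => //; rewrite /hyperosculating_Qiso qE.
  apply: (mult_tangent c P0 m0 (oner_neq0 _) _ aP).
  rewrite /on_curve eval_Qiso -aa.
  by apply: eq_bigr => i _; rewrite !aP !mul1r.
have [P1 [P2 [P10 P20 d [Q1 Q2] [l1 l2]]]] := secant_line_points aa.
constructor 2; exists P1, P2; split=> //.
by rewrite /bitangent_Qiso qE; split; apply: mult_secant.
Qed.

Lemma same_curve_Qiso :
  same_curve q Qiso <-> exists2 l, is_form 1 l & f = l * Qiso.
Proof.
split=> [[k k0 qk]|[l [hl l0] fE]]; last first.
  have := @conic_of_cubic l 1 0 hl; rewrite scale1r scale0r addr0 => /(_ fE).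
  by rewrite mulr0 scale0r addr0.
have [a [c [m [a0 qE fE]]]] := eigenscheme_conic hq hf hqf.
have [|ck m0] := @pencil_eq0 _ a (c - k) m a0.
  by rewrite scalerBl addrAC -qE qk subrr.
have {}ck : c = k by apply/eqP; rewrite -subr_eq0 ck.
exists (c *: lin a); last by rewrite fE m0 mul0r scale0r addr0 -scalerAr scalerAl.
split; first by rewrite rpredZ // lin_homog.
by rewrite -mul_mpolyC mulf_neq0 // mpolyC_eq0 ck.
Qed.

Lemma mult_pos_on_line a (c m : K) P n : P != 0 ->
  q = c *: Qiso + m *: lin a ^+ 2 -> intersection_mult q Qiso P n.+1 ->
  [/\ m != 0, on_curve Qiso P & on_curve (lin a) P].
Proof.
move=> P0 qE hn; have [qP QP] := intersection_mult_on_curves hq.1 (Qiso_homog K) hn.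
have m0 : m != 0.
  apply/eqP => m0; move: hn; rewrite qE m0 scale0r addr0.
  exact: mult_Qiso.
split=> //; apply/eqP; move/eqP: qP.
rewrite /on_curve /eval_at qE mevalD !mevalZ -!/(eval_at _ _) QP mulr0 add0r.
by rewrite expr2 eval_atM mulf_eq0 (negPf m0) mulf_eq0 orbb.
Qed.

(** Both coefficient vectors are multiples of the cross product of the two points. *)
Lemma join_proportional a b P1 P2 : P1 != 0 -> P2 != 0 ->
  distinct_points P1 P2 -> lin b != 0 ->
  on_curve (lin a) P1 -> on_curve (lin a) P2 ->
  on_curve (lin b) P1 -> on_curve (lin b) P2 ->
  exists t, forall i, a i = t * b i.
Proof.
rewrite /on_curve !eval_lin => P10 /row_neq0 P20 d b0 a1 a2 b1 b2.
pose N := cross (coord P1) (coord P2).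
have crossN x : dot x (coord P1) = 0 -> dot x (coord P2) = 0 ->
    forall i, cross x N i = 0.
  move=> x1 x2 i.
  transitivity (dot x (coord P2) * P1 0 i - dot x (coord P1) * P2 0 i).
    rewrite /dot !sum3; have [E0 E1 E2] := crossE x N.
    have [F0 F1 F2] := crossE (coord P1) (coord P2).
    by case: (ord3P i) => ->; rewrite ?E0 ?E1 ?E2 /N ?F0 ?F1 ?F2; ring.
  by rewrite x1 x2 !mul0r subr0.
have N0 : exists i, N i != 0.
  apply/existsP; apply: contraT; rewrite negb_exists => /forallP h.
  have {}h i : cross (coord P1) (coord P2) i = 0.
    by apply/eqP; have := h i; rewrite negbK.
  have [k hk] := cross_eq0_proportional h P20.
  case: (distinct_pointsP P10 d (k := k)).
  by apply/rowP => i; rewrite hk mxE.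
have [s hs] := cross_eq0_proportional (crossN _ b1 b2) N0.
have [t ht] := cross_eq0_proportional (crossN _ a1 a2) N0.
have s0 : s != 0.
  apply: contra_neq b0 => s0; rewrite /lin big1 // => i _.
  by rewrite hs s0 mul0r scale0r.
by exists (t / s) => i; rewrite ht hs mulrA divfK.
Qed.

Lemma bitangent_cubic r P1 P2 :
  P1 != 0 -> P2 != 0 -> distinct_points P1 P2 -> is_join r P1 P2 ->
  bitangent_Qiso q P1 P2 <->
  [/\ on_curve Qiso P1, on_curve Qiso P2
    & exists lambda mu : K, mu != 0 /\ f = r * (lambda *: Qiso + mu *: r ^+ 2)].
Proof.
move=> P10 P20 d [hr r1 r2]; have [b rE b0] := form1_lin hr; subst r.
split=> [[h1 h2]|[Q1 Q2 [l [mu [mu0 fE]]]]].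
  have [a [c [m [a0 qE fE]]]] := eigenscheme_conic hq hf hqf.
  have [m0 Q1 l1] := mult_pos_on_line P10 qE h1.
  have [_ Q2 l2] := mult_pos_on_line P20 qE h2.
  have [t at_] := join_proportional P10 P20 d b0 l1 l2 r1 r2.
  have aE : lin a = t *: lin b.
    by rewrite /lin scaler_sumr; apply: eq_bigr => i _; rewrite at_ scalerA.
  have t0 : t != 0 by apply: contra_neq a0 => t0; rewrite aE t0 scale0r.
  split=> //; exists (t * c), (m / 3%:R * t ^+ 3); split.
    by rewrite !mulf_neq0 ?invr_eq0 ?pnatr_eq0 ?expf_neq0.
  rewrite fE aE exprZn -scalerAl scalerAr scalerDr !scalerA.
  by congr (_ * (_ + _ *: _)); ring.
have [k k0 qE] := conic_of_cubic hr.1 fE.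
(* A tangent line would make [b] proportional to both points, contradicting their distinctness. *)
have bb : dot b b != 0.
  apply/eqP => bb; move: r1 r2 Q1 Q2; rewrite /on_curve !eval_lin !eval_Qiso.
  move=> b1 b2 Q1 Q2.
  have [s hs] := isotropic_orthogonal P10 Q1 b1 bb.
  have [t ht] := isotropic_orthogonal P20 Q2 b2 bb.
  have s0 : s != 0.
    apply: contra_neq b0 => s0; rewrite /lin big1 // => i _.
    by rewrite hs s0 mul0r scale0r.
  apply: (distinct_pointsP P10 d (k := t / s)).
  apply/rowP => i; rewrite mxE; apply: (mulfI s0).
  by rewrite -hs ht mulrA mulrCA divff ?mulr1.
have m0 : k * (3%:R * mu) != 0 by rewrite !mulf_neq0 ?pnatr_eq0.
rewrite /bitangent_Qiso qE scalerDr !scalerA.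
by split; apply: mult_secant.
Qed.

Lemma is_tangent_lin r P : is_tangent r Qiso P ->
  on_curve Qiso P /\ exists2 k, k != 0 & r = lin (fun i => k * P 0 i).
Proof.
move=> [QP [k k0 ->]]; split=> //; exists (k * 2%:R).
  by rewrite mulf_neq0 ?pnatr_eq0.
rewrite /lin scaler_sumr; apply: eq_bigr => i _.
by rewrite mderiv_Qiso /eval_at mevalMn mevalXU scalerA -mulrA mulr_natl.
Qed.

Lemma conic_of_tangent_cubic r P : is_tangent r Qiso P ->
  same_curve f (r * (Qiso - r ^+ 2)) ->
  same_curve q (Qiso - 3%:R *: r ^+ 2).
Proof.
move=> /is_tangent_lin[_ [k k0 rE]] [c c0 fE].
have hr : r \is 1.-homog by rewrite rE lin_homog.
have [|t t0 qE] := @conic_of_cubic r c (- c) hr.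
  by rewrite fE scalerAr scalerBr scaleNr.
exists (t * c); first by rewrite mulf_neq0.
by rewrite qE mulrN scaleNr [3%:R * c]mulrC -!scalerA -scalerBr.
Qed.

(** Excluding double lines means [c != 0] in the normal form, which is what allows [c] to be
    factored out of [c Q + (m / 3) l^2]. *)
Lemma hyperosculating_cubic P : P != 0 ->
  hyperosculating_Qiso q P /\ ~ double_line q <->
  exists2 r, is_tangent r Qiso P & same_curve f (r * (Qiso - r ^+ 2)).
Proof.
move=> P0; split=> [[h nd]|[r tr fE]].
  have [a [c [m [a0 qE fE]]]] := eigenscheme_conic hq hf hqf.
  have [m0 QP lP] := mult_pos_on_line P0 qE h.
  have c0 : c != 0.
    apply/eqP => c0; apply: nd; exists (lin a).
      by split=> //; exact: lin_homog.
    by exists m; rewrite // qE c0 scale0r add0r.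
  (* A secant would give multiplicity 2 at [P], against the uniqueness of the multiplicity. *)
  have aa : dot a a = 0.
    apply/eqP; apply: contraT => aa; move: h; rewrite /hyperosculating_Qiso qE.
    by move/(intersection_mult_uniq (mult_secant c P0 m0 QP lP aa)).
  have [k ak] : exists k, forall i, a i = k * P 0 i.
    move: QP lP; rewrite /on_curve eval_lin eval_Qiso => PP aP.
    exact: isotropic_orthogonal.
  have k0 : k != 0.
    apply: contra_neq a0 => k0; rewrite /lin big1 // => i _.
    by rewrite ak k0 mul0r scale0r.
  have n3 : 3%:R != 0 :> K by rewrite pnatr_eq0.
  have n2 : 2%:R != 0 :> K by rewrite pnatr_eq0.
  (* Chosen so that [r = t l] satisfies [c (Q - r^2) = c Q + (m / 3) l^2]. *)
  pose t := sqrtC (- (m / 3%:R / c)).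
  have t2 : t ^+ 2 = - (m / 3%:R / c) by rewrite sqrtCK.
  have t0 : t != 0 by rewrite sqrtC_eq0 oppr_eq0 !mulf_neq0 ?invr_eq0.
  exists (t *: lin a).
    split=> //; exists (t * k / 2%:R); first by rewrite !mulf_neq0 ?invr_eq0.
    rewrite /lin !scaler_sumr; apply: eq_bigr => i _.
    rewrite mderiv_Qiso /eval_at mevalMn mevalXU !scalerA ak; congr (_ *: _).
    by rewrite -[P 0 i *+ 2]mulr_natl [RHS]mulrA divfK // mulrA.
  exists (c / t); first by rewrite mulf_neq0 ?invr_eq0.
  rewrite fE -scalerAl scalerA divfK // [RHS]scalerAr; congr (_ * _).
  by rewrite scalerBr exprZn t2 scaleNr scalerN opprK scalerA mulrCA divff ?mulr1.
have [QP [k k0 rE]] := is_tangent_lin tr.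
have [c c0 qE] := conic_of_tangent_cubic tr fE.
split.
  rewrite /hyperosculating_Qiso qE scalerBr scalerA -scaleNr rE.
  apply: (mult_tangent c P0 _ k0 QP) => //.
  by rewrite oppr_eq0 mulf_neq0 ?pnatr_eq0.
(* A double line would express [Q] as [3 r^2 + (d / c) b^2], of rank at most 2. *)
move=> [l /form1_lin[b -> _] [d d0 qd]].
apply: (@Qiso_rank K (fun i => k * P 0 i) b 3%:R (d / c)).
rewrite -rE; apply/eqP; rewrite addrC -subr_eq; apply/eqP.
by apply: (scalerI c0); rewrite -qE qd scalerA mulrC divfK.
Qed.

End Cubic.
End Classification.

Theorem theorem6p8 (R : realType) (q f : {mpoly R[i][3]})
    (hq : is_form 2 q) (hf : is_form 3 f)
    (hqf : curve_in_eigenscheme q f) :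
  [/\ [\/ same_curve q Qiso,
          exists P1 P2 : 'rV[R[i]]_3,
            [/\ P1 != 0, P2 != 0, distinct_points P1 P2
              & bitangent_Qiso q P1 P2]
        | exists2 P : 'rV[R[i]]_3, P != 0 & hyperosculating_Qiso q P],
      same_curve q Qiso <->
        (exists2 l : {mpoly R[i][3]}, is_form 1 l & f = l * Qiso),
      (forall (P1 P2 : 'rV[R[i]]_3) (r : {mpoly R[i][3]}),
        P1 != 0 -> P2 != 0 -> distinct_points P1 P2 -> is_join r P1 P2 ->
        (bitangent_Qiso q P1 P2 <->
           [/\ on_curve Qiso P1, on_curve Qiso P2
             & exists lambda mu : R[i],
                 mu != 0 /\ f = r * (lambda *: Qiso + mu *: r ^+ 2)]) /\
        (forall lambda mu : R[i],
           f = r * (lambda *: Qiso + mu *: r ^+ 2) ->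
           same_curve q (lambda *: Qiso + (3%:R * mu) *: r ^+ 2)))
    & (forall P : 'rV[R[i]]_3, P != 0 ->
        (hyperosculating_Qiso q P /\ ~ double_line q <->
           exists2 r : {mpoly R[i][3]}, is_tangent r Qiso P
             & same_curve f (r * (Qiso - r ^+ 2))) /\
        (forall r : {mpoly R[i][3]}, is_tangent r Qiso P ->
           same_curve f (r * (Qiso - r ^+ 2)) ->
           same_curve q (Qiso - 3%:R *: r ^+ 2)))].
Proof.
split.
- exact: (hyperosculating_or_bitangent hq hf hqf).
- exact: (same_curve_Qiso hq hf hqf).
- move=> P1 P2 r P10 P20 d hr; split; first exact: (bitangent_cubic hq hf hqf).
  by move=> l mu; case: hr => [[hr _] _ _]; apply: (conic_of_cubic hq hf hqf hr).
- move=> P P0; split; first exact: (hyperosculating_cubic hq hf hqf).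
  by move=> r; apply: (conic_of_tangent_cubic hq hf hqf).
Qed.
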